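(* Let $(R,\mathfrak m,K)$ be a one-dimensional $F$-finite local ring of prime characteristic $p>0$, and let $M$ be an $R$-module of finite length. If $\beta_i^F(M,R)=\beta_{i+1}^F(M,R)=0$ for some $i\ge 1$, then $\operatorname{pd}_R(M)<\infty$. In particular, for any parameter $x$ of $R$, if $\beta_2^F(R/(x),R)=0$ then $R$ is Cohen-Macaulay.
   Context: Rings are commutative and Noetherian. A ring of prime characteristic $p$ is $F$-finite if it is a finitely generated module over itself via the Frobenius endomorphism. For an $R$-module $N$ and $e\ge 0$, ${}^eN$ denotes $N$ with the $R$-module structure $r*n=r^{p^e}n$. For a local ring $(R,\mathfrak m,K)$ put $d=\dim R$, $\alpha=\log_p[K:K^p]$ and $q=p^e$; $\lambda$ denotes length of $R$-modules. For $M$ of finite length and $N$ finitely generated, $\beta_i^F(M,N)=\lim_{e\to\infty}\lambda(\operatorname{Tor}^R_i(M,{}^eN))/q^{d+\alpha}$; this limit is known to exist. A parameter of $R$ is an element $x\in R$ with $\dim(R/(x))=\dim R-1$ (the zero module has dimension $-1$). The zero module has projective dimension $-\infty$. *)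

(* Defs.v *)
From HB Require Import structures.
From mathcomp Require Import all_boot all_order all_algebra.
From mathcomp Require Import all_classical all_reals all_analysis.
From mathcomp Require Import finmap.
(* The notations of [monalg] are incompatible with those of MathComp-Analysis. *)
From mathcomp.multinomials Require Import -(notations) monalg.

Set Implicit Arguments.
Unset Strict Implicit.
Unset Printing Implicit Defensive.

Import Order.TTheory GRing.Theory Num.Theory.
Import numFieldNormedType.Exports.

Local Open Scope classical_set_scope.
Local Open Scope ring_scope.

(** ** Submodules and quotients *)

Definition proper_subpred (T : Type) (A B : {pred T}) : Prop :=
  {subset A <= B} /\ ~ {subset B <= A}.

Section Quotient.
Variables (R : pzRingType) (V : lmodType R) (S : submodClosed V).
Local Open Scope quotient_scope.

(* A [submodClosed] has no [zmodClosed] instance, which [{ideal_quot _}] needs. *)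
Definition zmod_pred : {pred V} := S.

Lemma zmod_pred_closed : zmod_closed zmod_pred.
Proof. exact: GRing.submod_closedB (submodClosedP S). Qed.
HB.instance Definition _ := GRing.isZmodClosed.Build V zmod_pred zmod_pred_closed.

Definition quot_mod : Type := {ideal_quot zmod_pred}.
HB.instance Definition _ := GRing.Zmodule.on quot_mod.
HB.instance Definition _ := EqQuotient.on quot_mod.
Local Notation Q := quot_mod.

Definition quot_pi : V -> Q := \pi_Q.

Lemma quot_piE x y : (quot_pi x == quot_pi y) = (x - y \in S).
Proof. by rewrite -(Quotient.idealrBE zmod_pred). Qed.

Lemma quot_piK (v : Q) : quot_pi (repr v) = v.
Proof. exact: reprK. Qed.

Definition quot_scale (a : R) : Q -> Q := lift_op1 Q ( *:%R a).

Lemma quot_scaleE a x : quot_scale a (quot_pi x) = quot_pi (a *: x).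
Proof.
rewrite /quot_scale; unlock; apply/eqP; rewrite quot_piE -scalerBr rpredZ //.
by rewrite -quot_piE quot_piK.
Qed.

Lemma quot_pi_is_zmod_morphism : zmod_morphism quot_pi.
Proof. by move=> x y; rewrite /quot_pi raddfB. Qed.
HB.instance Definition _ := GRing.isZmodMorphism.Build V Q quot_pi
  quot_pi_is_zmod_morphism.

Lemma quot_scaleA a b v : quot_scale a (quot_scale b v) = quot_scale (a * b) v.
Proof. by rewrite -[v]quot_piK !quot_scaleE scalerA. Qed.

Lemma quot_scale1 : left_id 1 quot_scale.
Proof. by move=> v; rewrite -[v]quot_piK quot_scaleE scale1r. Qed.

Lemma quot_scaleDr : right_distributive quot_scale +%R.
Proof.
by move=> a u v; rewrite -[u]quot_piK -[v]quot_piK -!raddfD !quot_scaleE scalerDr raddfD.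
Qed.

Lemma quot_scaleDl v : {morph quot_scale^~ v : a b / a + b}.
Proof. by move=> a b; rewrite -[v]quot_piK !quot_scaleE scalerDl raddfD. Qed.

HB.instance Definition _ := GRing.Zmodule_isLmodule.Build R Q
  quot_scaleA quot_scale1 quot_scaleDr quot_scaleDl.

Lemma quot_pi_is_scalable : scalable quot_pi.
Proof. by move=> a x; rewrite -quot_scaleE. Qed.
HB.instance Definition _ := GRing.isScalable.Build R V Q *:%R quot_pi
  quot_pi_is_scalable.

Variables (W : lmodType R) (f : {linear V -> W}).
Variable fS : forall v, v \in S -> f v = 0.

Definition quot_lift of (forall v, v \in S -> f v = 0) : Q -> W :=
  fun v => f (repr v).
Local Notation lift := (quot_lift fS).

Lemma quot_liftE x : lift (quot_pi x) = f x.
Proof.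
apply/eqP; rewrite -subr_eq0 -raddfB; apply/eqP/fS.
by rewrite -quot_piE quot_piK.
Qed.

Lemma quot_lift_linear : linear lift.
Proof.
move=> a u v; rewrite -[u]quot_piK -[v]quot_piK -linearP.
by rewrite !quot_liftE linearP.
Qed.

HB.instance Definition _ := GRing.isLinear.Build R Q W *:%R lift quot_lift_linear.
End Quotient.

Section SubmoduleType.
Variables (R : pzRingType) (V : lmodType R) (S : submodClosed V).

Definition submod_type := {x : V | x \in S}.
HB.instance Definition _ := SubChoice.on submod_type.
HB.instance Definition _ := [SubChoice_isSubLmodule of submod_type by <:].
End SubmoduleType.

Section SpanKernelImage.
Variables (R : pzRingType) (V W : lmodType R).

Definition gen_submod (A : set V) : {pred V} := fun v => `[< exists n (c : 'I_n -> R)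
  (a : 'I_n -> V), (forall i, A (a i)) /\ v = \sum_i c i *: a i >].

Lemma gen_submod_closed A : subsemimod_closed (gen_submod A).
Proof.
split; first split.
- by apply/asboolP; exists 0%N, (fun=> 0), (fun=> 0); split=> [[]//|]; rewrite big_ord0.
- move=> u v /asboolP[n [c [a [Aa ->]]]] /asboolP[m [d [b [Ab ->]]]].
  apply/asboolP; exists (n + m)%N.
  exists (fun i => match fintype.split i with inl j => c j | inr j => d j end).
  exists (fun i => match fintype.split i with inl j => a j | inr j => b j end).
  split=> [i|]; first by case: fintype.split.
  rewrite big_split_ord /=; congr (_ + _); apply: eq_bigr => i _.
    by rewrite (unsplitK (inl i)).
  by rewrite (unsplitK (inr i)).
- move=> r u /asboolP[n [c [a [Aa ->]]]]; apply/asboolP.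
  exists n, (fun i => r * c i), a; split=> //.
  by rewrite scaler_sumr; apply: eq_bigr => i _; rewrite scalerA.
Qed.
HB.instance Definition _ A :=
  GRing.isSubmodClosed.Build R V (gen_submod A) (gen_submod_closed A).

Definition fin_generated : Prop :=
  exists s : seq V, forall v, v \in gen_submod [set` s].

Definition lin_ker (f : {linear V -> W}) : {pred V} := fun v => f v == 0.

Lemma lin_ker_closed f : subsemimod_closed (lin_ker f).
Proof.
split; first split.
- by rewrite unfold_in linear0.
- by move=> u v /eqP fu /eqP fv; rewrite unfold_in linearD fu fv addr0.
- by move=> a v /eqP fv; rewrite unfold_in linearZ /= fv scaler0.
Qed.
HB.instance Definition _ f :=
  GRing.isSubmodClosed.Build R V (lin_ker f) (lin_ker_closed f).

Definition lin_im (f : {linear V -> W}) : {pred W} := fun w => `[< exists v, f v = w >].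

Lemma lin_im_closed f : subsemimod_closed (lin_im f).
Proof.
split; first split.
- by apply/asboolP; exists 0; rewrite linear0.
- move=> _ _ /asboolP[u <-] /asboolP[v <-].
  by apply/asboolP; exists (u + v); rewrite linearD.
- by move=> a _ /asboolP[v <-]; apply/asboolP; exists (a *: v); rewrite linearZ.
Qed.
HB.instance Definition _ f :=
  GRing.isSubmodClosed.Build R W (lin_im f) (lin_im_closed f).
End SpanKernelImage.
Arguments fin_generated {R} V.

Section Homology.
Variables (R : pzRingType) (A B C : lmodType R).
Variables (f : {linear A -> B}) (g : {linear B -> C}).

Definition boundaries : {pred submod_type (lin_ker g)} := fun z => val z \in lin_im f.

Lemma boundaries_closed : subsemimod_closed boundaries.
Proof.
split; first split.
- by rewrite unfold_in linear0 rpred0.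
- by move=> u v fu fv; rewrite unfold_in linearD rpredD.
- by move=> a v fv; rewrite unfold_in linearZ rpredZ.
Qed.
HB.instance Definition _ :=
  GRing.isSubmodClosed.Build R (submod_type (lin_ker g)) boundaries boundaries_closed.

(* The usual ker g / im f when g \o f = 0; in general ker g / (im f :&: ker g). *)
Definition homology : lmodType R := quot_mod boundaries.
End Homology.

(** ** Free modules, tensor products and Tor *)

Section FreeLift.
Variables (R : nzRingType) (K : choiceType) (V : lmodType R) (f : K -> V).

Definition free_lift (g : malg K R) : V := \sum_(k <- msupp g) mcoeff k g *: f k.

Lemma free_liftEw (d : {fset K}) g :
  (msupp g `<=` d)%fset -> free_lift g = \sum_(k <- d) mcoeff k g *: f k.
Proof.
move=> le; rewrite /free_lift (big_fset_incl _ le) //= => k _.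
by move/mcoeff_outdom=> ->; rewrite scale0r.
Qed.

Lemma free_lift_linear : linear free_lift.
Proof.
move=> a u v; pose d := (msupp (a *: u + v) `|` msupp u `|` msupp v)%fset.
rewrite !(@free_liftEw d); first 1 last.
- by rewrite /d fsubsetUr.
- by rewrite /d -fsetUA fsetUC -fsetUA fsubsetUl.
- by rewrite /d -fsetUA fsubsetUl.
rewrite scaler_sumr -big_split; apply: eq_bigr => k _ /=.
by rewrite mcoeffD mcoeffZ scalerDl scalerA.
Qed.
HB.instance Definition _ :=
  GRing.isLinear.Build R (malg K R) V *:%R free_lift free_lift_linear.
End FreeLift.

Section Tensor.
Variables (R : comNzRingType).

Definition pure_sym (M N : lmodType R) (x : M) (y : N) : malg (M * N)%type R :=
  mkmalgU (x, y) 1.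

Definition tensor_rel (M N : lmodType R) : set (malg (M * N)%type R) :=
  [set pure_sym (z.1.1 + z.1.2) z.2 - pure_sym z.1.1 z.2 - pure_sym z.1.2 z.2
     | z in [set: M * M * N]]
  `|` [set pure_sym z.1 (z.2.1 + z.2.2) - pure_sym z.1 z.2.1 - pure_sym z.1 z.2.2
     | z in [set: M * (N * N)]]
  `|` [set pure_sym (z.1 *: z.2.1) z.2.2 - z.1 *: pure_sym z.2.1 z.2.2
     | z in [set: R * (M * N)]]
  `|` [set pure_sym z.2.1 (z.1 *: z.2.2) - z.1 *: pure_sym z.2.1 z.2.2
     | z in [set: R * (M * N)]].

Definition tensor (M N : lmodType R) : lmodType R :=
  quot_mod (gen_submod (@tensor_rel M N)).

Definition tens (M N : lmodType R) (x : M) (y : N) : tensor M N :=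
  quot_pi (gen_submod (@tensor_rel M N)) (pure_sym x y).

Section TensorMap.
Variables (M M' N : lmodType R) (f : {linear M -> M'}).

Definition tensor_gen : {linear malg (M * N)%type R -> tensor M' N} :=
  free_lift (fun z : M * N => tens (f z.1) z.2).

Lemma tensor_genE x y : tensor_gen (pure_sym x y) = tens (f x) y.
Proof.
rewrite /tensor_gen /= (@free_liftEw _ _ _ _ [fset (x, y)]%fset) ?msuppU_le //.
by rewrite big_seq_fset1 mcoeffUU scale1r.
Qed.

Lemma tensor_gen_rel v :
  v \in gen_submod (@tensor_rel M N) -> tensor_gen v = 0.
Proof.
move=> /asboolP[n [c [a [ra ->]]]]; rewrite linear_sum big1 // => i _.
rewrite linearZ /=; suff -> : tensor_gen (a i) = 0 by rewrite scaler0.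
have rel0 w : tensor_rel w -> quot_pi (gen_submod (@tensor_rel M' N)) w = 0.
  move=> rw; apply/eqP; rewrite -(linear0 (quot_pi _)) quot_piE subr0.
  apply/asboolP; exists 1%N, (fun=> 1), (fun=> w).
  by rewrite big_ord1 scale1r.
case: (ra i) => [[[|]|]|] [z _ <-].
- rewrite !linearB !tensor_genE.
  transitivity (quot_pi (gen_submod (@tensor_rel M' N))
    (pure_sym (f z.1.1 + f z.1.2) z.2 - pure_sym (f z.1.1) z.2
       - pure_sym (f z.1.2) z.2)); first by rewrite !linearB linearD.
  by apply: rel0; left; left; left; exists (f z.1.1, f z.1.2, z.2).
- rewrite !linearB !tensor_genE.
  transitivity (quot_pi (gen_submod (@tensor_rel M' N))
    (pure_sym (f z.1) (z.2.1 + z.2.2) - pure_sym (f z.1) z.2.1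
       - pure_sym (f z.1) z.2.2)); first by rewrite !linearB.
  by apply: rel0; left; left; right; exists (f z.1, z.2).
- rewrite linearB linearZ /= !tensor_genE.
  transitivity (quot_pi (gen_submod (@tensor_rel M' N))
    (pure_sym (z.1 *: f z.2.1) z.2.2 - z.1 *: pure_sym (f z.2.1) z.2.2)).
    by rewrite [RHS]linearB [X in _ = _ - X]linearZ [f (_ *: _)]linearZ.
  by apply: rel0; left; right; exists (z.1, (f z.2.1, z.2.2)).
- rewrite linearB linearZ /= !tensor_genE.
  transitivity (quot_pi (gen_submod (@tensor_rel M' N))
    (pure_sym (f z.2.1) (z.1 *: z.2.2) - z.1 *: pure_sym (f z.2.1) z.2.2)).
    by rewrite [RHS]linearB [X in _ = _ - X]linearZ.
  by apply: rel0; right; exists (z.1, (f z.2.1, z.2.2)).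
Qed.

Definition tensor_map : {linear tensor M N -> tensor M' N} :=
  quot_lift tensor_gen_rel.

Lemma tensor_mapE x y : tensor_map (tens x y) = tens (f x) y.
Proof. exact: etrans (quot_liftE _ _) (tensor_genE _ _). Qed.
End TensorMap.
End Tensor.

Section Tor.
Variables (R : comNzRingType) (M : lmodType R).

(* The canonical free resolution of M: F_i is free on the underlying set of the
   i-th syzygy Z_i, where Z_0 = M and Z_(i+1) is the kernel of F_i ->> Z_i. *)
Definition free_cover (V : lmodType R) : {linear malg V R -> V} := free_lift id.

Fixpoint syzygy (i : nat) : lmodType R :=
  if i is j.+1 then submod_type (lin_ker (free_cover (syzygy j))) else M.

Definition free_res (i : nat) : lmodType R := malg (syzygy i) R.

Definition free_res_diff (i : nat) : {linear free_res i.+1 -> free_res i} :=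
  (val : submod_type (lin_ker (free_cover (syzygy i))) -> free_res i)
    \o free_cover (syzygy i.+1).

Variable N : lmodType R.

Definition tor_diff (i : nat) :
    {linear tensor (free_res i.+1) N -> tensor (free_res i) N} :=
  tensor_map N (free_res_diff i).

Definition Tor (i : nat) : lmodType R :=
  if i is j.+1 then homology (tor_diff j.+1) (tor_diff j)
  else homology (tor_diff 0)
         (\0 : {linear tensor (free_res 0) N -> tensor (free_res 0) N}).
End Tor.

(** ** Length, dimension, depth, projective dimension *)

Section Invariants.
Variables (RR : realType) (R : comNzRingType).

Definition submod_chain (M : lmodType R) (n : nat) : Prop :=
  exists c : nat -> submodClosed M,
    forall i, (i < n)%N -> proper_subpred (c i) (c i.+1).

Definition mod_length (M : lmodType R) : \bar RR :=
  ereal_sup [set n%:R%:E | n in submod_chain M].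

Definition finite_length (M : lmodType R) : Prop := (mod_length M < +oo)%E.

(* A chain of k primes containing Ann M has length k - 1; allowing k = 0 makes the
   dimension of the zero module equal to -1. *)
Definition prime_chain (M : lmodType R) (k : nat) : Prop :=
  exists c : 'I_k -> prime_idealr R,
    (forall i (a : R), (forall x : M, a *: x = 0) -> a \in c i)
    /\ (forall i j : 'I_k, (i < j)%N -> proper_subpred (c i) (c j)).

Definition krull_dim (M : lmodType R) : \bar RR :=
  ereal_sup [set (k%:R - 1)%:E | k in prime_chain M].

Definition noetherian : Prop :=
  forall I : submodClosed R^o, exists s : seq R^o, I =i gen_submod [set` s].

(* An [idealr] is a proper ideal. *)
Definition maximal_ideal (m : idealr R) : Prop :=
  forall I : idealr R, {subset m <= I} -> I =i m.

Definition local_ring (m : idealr R) : Prop :=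
  maximal_ideal m /\ forall n : idealr R, maximal_ideal n -> n =i m.

Definition ring_quot (A : set R^o) : lmodType R := quot_mod (gen_submod A).

Definition parameter (x : R) : Prop :=
  krull_dim (ring_quot [set x]) = (krull_dim R^o - 1)%E.

Definition regular_seq (m : idealr R) (s : seq R^o) : Prop :=
  forall i, (i < size s)%N ->
    s`_i \in m /\ forall y : ring_quot [set` take i s],
      (s`_i : R) *: y = 0 -> y = 0.

Definition depth (m : idealr R) : \bar RR :=
  ereal_sup [set (size s)%:R%:E | s in regular_seq m].

Definition cohen_macaulay (m : idealr R) : Prop := depth m = krull_dim R^o.

Definition projective_mod (P : lmodType R) : Prop :=
  forall (A B : lmodType R) (g : {linear A -> B}) (f : {linear P -> B}),
    (forall b, exists a, g a = b) ->
    exists h : {linear P -> A}, forall x, g (h x) = f x.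

Definition exact_at (A B C : lmodType R) (f : A -> B) (g : B -> C) : Prop :=
  forall y, g y = 0 <-> exists x, f x = y.

Definition proj_resolution (M : lmodType R) (n : nat) : Prop :=
  exists (P : nat -> lmodType R) (d : forall i, {linear P i.+1 -> P i})
         (e : {linear P 0%N -> M}),
    [/\ forall i, projective_mod (P i),
        forall x, exists y, e y = x,
        exact_at (d 0%N) e,
        forall i, exact_at (d i.+1) (d i)
      & forall i, (n < i)%N -> forall x : P i, x = 0].

Definition projdim (M : lmodType R) : \bar RR :=
  if `[< forall x : M, x = 0 >] then -oo%E
  else ereal_inf [set n%:R%:E | n in proj_resolution M].
End Invariants.
Arguments mod_length RR {R} M.
Arguments finite_length RR {R} M.
Arguments krull_dim RR {R} M.
Arguments noetherian R : clear implicits.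
Arguments parameter RR {R} x.
Arguments depth RR {R} m.
Arguments cohen_macaulay RR {R} m.
Arguments projdim RR {R} M.

(** ** Frobenius *)

Section Frobenius.
Variables (R : comNzRingType) (p : nat) (charRp : p \in [pchar R]).

(* The underlying set of N with the action r * n = r^(p^e) n; the characteristic
   hypothesis is an argument because this is a module structure only then. *)
Definition frob_twist of p \in [pchar R] := fun (e : nat) (N : lmodType R) => N : Type.
Local Notation twist := (frob_twist charRp).

Section Module.
Variables (e : nat) (N : lmodType R).
HB.instance Definition _ := GRing.Zmodule.on (twist e N).

Definition frob_scale (r : R) (n : twist e N) : twist e N :=
  r ^+ (p ^ e) *: (n : N).

Lemma frob_scaleA a b v : frob_scale a (frob_scale b v) = frob_scale (a * b) v.
Proof. by rewrite /frob_scale scalerA exprMn. Qed.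

Lemma frob_scale1 : left_id 1 frob_scale.
Proof. by move=> v; rewrite /frob_scale expr1n scale1r. Qed.

Lemma frob_scaleDr : right_distributive frob_scale +%R.
Proof. by move=> a u v; rewrite /frob_scale scalerDr. Qed.

Lemma frob_scaleDl v : {morph frob_scale^~ v : a b / a + b}.
Proof.
move=> a b; rewrite /frob_scale -scalerDl; congr (_ *: _).
by rewrite exprDn_pchar // pnatX pnatE ?charRp ?(pcharf_prime charRp).
Qed.

HB.instance Definition _ := GRing.Zmodule_isLmodule.Build R (twist e N)
  frob_scaleA frob_scale1 frob_scaleDr frob_scaleDl.
End Module.

Definition F_finite : Prop := fin_generated (twist 1 R^o).
End Frobenius.

(* [K : K^p] = n, where K^p is the set of p-th powers. *)
Definition frob_basis (K : comNzRingType) (p n : nat) : Prop :=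
  exists b : 'I_n -> K, forall y : K, exists! c : 'I_n -> K,
    (forall i, exists a, c i = a ^+ p) /\ y = \sum_i c i * b i.

(* The junk value 0 is never taken when K is the residue field of an F-finite
   local ring. *)
Definition frob_degree (K : comNzRingType) (p : nat) : nat :=
  xget 0%N (frob_basis K p).

Section FrobeniusBetti.
Variables (RR : realType) (R : comNzRingType) (p : nat).
Variables (charRp : p \in [pchar R]) (m : idealr R).

Definition residue_field : comNzRingType := {ideal_quot m}.

Definition alpha : RR := ln (frob_degree residue_field p)%:R / ln p%:R.

Definition frob_betti_seq (i : nat) (M N : lmodType R) (e : nat) : \bar RR :=
  (mod_length RR (Tor M (frob_twist charRp e N) i)
   * (((p ^ e)%:R `^ (fine (krull_dim RR R^o) + alpha))^-1)%:E)%E.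

(* beta_i^F(M, N) = b.  This is a relation, rather than an equation on [lim],
   because [lim] has a junk value on divergent sequences. *)
Definition frob_betti_is (i : nat) (M N : lmodType R) (b : \bar RR) : Prop :=
  frob_betti_seq i M N @ \oo --> b.
End FrobeniusBetti.
Arguments frob_betti_is RR {R p} charRp m i M N b.

(* Main.v *)
Require Import Defs.
From HB Require Import structures.
From mathcomp Require Import all_boot all_order all_algebra.
From mathcomp Require Import all_classical all_reals all_analysis.
From mathcomp Require Import finmap.
From mathcomp Require Import ring lra zify.
From mathcomp.multinomials Require Import -(notations) monalg.

(** Let [Z_e] be the kernel of the Frobenius power [A_i^[q]] of the [i]-th matrix of the minimal
    resolution of [M], with [q = p^e], and let [B_e] be the image of [A_{i+1}^[q]], so that
    [Z_e / B_e] is [Tor_i (M, ^eR)].  Choose [y] in [m] with [rad (y) = m] and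
    [ann y = ann (y^2)].  The entries of [A_{i+1}] lie in [m], so some fixed power [n0] of each of
    them is divisible by [y], and [B_e] is contained in [y^(k-1) Z_e] with [k = q %/ n0].  If
    [y Z_e <> 0], then by Nakayama's lemma [Z_e > y Z_e > y^2 Z_e > ...] is strict, and each step
    contributes at least [[K : K^q] = q^alpha] to the length of the twisted module; so the length
    of [Tor_i] is at least about [q^(1+alpha) / n0].  Hence [beta_i = 0] forces [y Z_e = 0] and
    [B_e = 0] for large [e]: the matrix [A_{i+1}^[q]] vanishes, while [y] kills [ker A_i^[q]].
    Applied at [i] and [i+1], this makes [y] kill the source of [A_{i+1}], which is therefore
    zero.  Applied to [R/x] in degree [2], it shows that [y] kills [ker A_2^[q]], where [A_2]
    lists generators of [ann x]; with [y] a power of [x] this kernel contains [y] times the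
    standard basis, so [ann x = 0] because [y ^ 2 <> 0]. *)

Set Implicit Arguments.
Unset Strict Implicit.
Unset Printing Implicit Defensive.

Import Order.TTheory GRing.Theory Num.Theory.
Local Open Scope ring_scope.
Local Open Scope classical_set_scope.

(** * Submodules and Noetherian rings *)

Section Submodules.
Variables (R : pzRingType) (V : lmodType R).

(** A predicate on plain sets, so that one set of vectors can be tested over [V] and over its
    Frobenius twist. *)
Definition is_submod (A : set V) : Prop :=
  [/\ A 0, forall u v, A u -> A v -> A (u + v) & forall a u, A u -> A (a *: u)].

Lemma is_submodB A u v : is_submod A -> A u -> A v -> A (u - v).
Proof. by case=> _ AD AZ Au Av; apply: AD => //; rewrite -scaleN1r; apply: AZ. Qed.

Lemma is_submod_sum A (I : finType) (P : pred I) (F : I -> V) :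
  is_submod A -> (forall i, P i -> A (F i)) -> A (\sum_(i | P i) F i).
Proof. by case=> A0 AD _ AF; apply: (big_ind A). Qed.

Lemma mem_gen_submod A v : is_submod A -> v \in gen_submod A <-> A v.
Proof.
move=> sA; have [A0 AD AZ] := sA; split=> [/asboolP[n [c [a [Aa ->]]]]|Av].
  by apply: is_submod_sum => // i _; apply: AZ.
by apply/asboolP; exists 1%N, (fun=> 1), (fun=> v); rewrite big_ord1 scale1r.
Qed.

Lemma is_submod_mem (S : submodClosed V) : is_submod [set v | v \in S].
Proof.
split=> /= [|u v|a u]; [exact: rpred0 | exact: rpredD | exact: rpredZ].
Qed.

Definition span n (g : 'I_n -> V) : set V :=
  [set v | exists c : 'I_n -> R, v = \sum_i c i *: g i].

Lemma is_submod_span n (g : 'I_n -> V) : is_submod (span g).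
Proof.
split=> [|_ _ [c ->] [d ->]|a _ [c ->]].
- by exists (fun=> 0); rewrite big1 // => i _; rewrite scale0r.
- exists (fun i => c i + d i); rewrite -big_split.
  by apply: eq_bigr => i _; rewrite scalerDl.
- exists (fun i => a * c i); rewrite scaler_sumr.
  by apply: eq_bigr => i _; rewrite scalerA.
Qed.

Lemma span_gen n (g : 'I_n -> V) i : span g (g i).
Proof.
exists (fun j => (j == i)%:R); rewrite (bigD1 i) //= eqxx scale1r big1 ?addr0 //.
by move=> j /negPf->; rewrite scale0r.
Qed.

Lemma span_min n (g : 'I_n -> V) A :
  is_submod A -> (forall i, A (g i)) -> span g `<=` A.
Proof.
move=> sA Ag _ [c ->]; apply: is_submod_sum => // i _.
by case: sA => _ _; apply.
Qed.

Lemma gen_submod_seq (s : seq V) v :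
  v \in gen_submod [set` s] -> span (fun i : 'I_(size s) => s`_i) v.
Proof.
move=> /asboolP[n [c [a [sa ->]]]]; have ss := is_submod_span (fun i : 'I_(size s) => s`_i).
apply: is_submod_sum => // i _; case: (ss) => _ _; apply.
have /= si := sa i; have lt_s : (index (a i) s < size s)%N by rewrite index_mem.
by rewrite -(nth_index 0 si); exact: (span_gen _ (Ordinal lt_s)).
Qed.

Definition fg_set (A : set V) : Prop :=
  exists n (g : 'I_n -> V), (forall i, A (g i)) /\ A `<=` span g.

End Submodules.

Definition fg (R : pzRingType) (V : lmodType R) : Prop := fg_set [set: V].

Lemma mod_length_ge (RR : realType) (R : comNzRingType) (M : lmodType R)
    (c : nat -> set M) n :
  (forall i, (i <= n)%N -> is_submod (c i)) ->
  (forall i, (i < n)%N -> c i `<=` c i.+1 /\ exists v, c i.+1 v /\ ~ c i v) ->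
  (n%:R%:E <= mod_length RR M)%E.
Proof.
move=> sc cc; apply: ereal_sup_ubound; exists n => //.
exists (fun i => gen_submod (c i) : submodClosed M) => i lt_in.
have [le_c [v [cv ncv]]] := cc i lt_in.
have s1 := sc i (ltnW lt_in); have s2 := sc i.+1 lt_in.
split=> [u /(mem_gen_submod _ s1) /le_c /(mem_gen_submod _ s2) //|le].
by apply/ncv/(mem_gen_submod _ s1)/le/(mem_gen_submod _ s2).
Qed.

(** If no finite family generates [M], one can keep choosing vectors outside the span of the earlier
    ones, and the spans form strict chains of every length. *)
Lemma finite_length_fg (RR : realType) (R : comNzRingType) (M : lmodType R) :
  finite_length RR M -> fg M.
Proof.
move=> flM; apply: contrapT => nfg; move: flM; rewrite /finite_length.
suff -> : mod_length RR M = +oo%E by rewrite ltxx.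
pose st (s : seq M) i := span (fun j : 'I_i => s`_j).
have Pn n : exists s : seq M, size s = n /\ forall i, (i < n)%N -> ~ st s i s`_i.
  elim: n => [|n [s [ss sP]]]; first by exists [::].
  have [v nv] : exists v, ~ st s n v.
    apply: contrapT => nv; apply: nfg; exists n, (fun j => s`_j); split=> // v _.
    by apply: contrapT => nsv; apply: nv; exists v.
  exists (rcons s v); split=> [|i]; first by rewrite size_rcons ss.
  have st_rcons j : (j <= n)%N -> st (rcons s v) j = st s j.
    move=> le_jn; rewrite /st; congr span; apply/funext => k.
    by rewrite nth_rcons ss (leq_trans (ltn_ord k)).
  rewrite ltnS leq_eqVlt => /predU1P[->|lt_in].
    by rewrite st_rcons // nth_rcons ss ltnn eqxx.
  by rewrite st_rcons ?nth_rcons ?ss ?lt_in //; [exact: sP | exact: ltnW].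
have len n : (n%:R%:E <= mod_length RR M)%E.
  have [s [ss sP]] := Pn n.
  apply: (@mod_length_ge _ _ _ (st s)) => [i _|i lt_in]; first exact: is_submod_span.
  split; last by exists s`_i; split; [exact: (span_gen _ (@ord_max i)) | exact: sP].
  apply: span_min => [|j]; first exact: is_submod_span.
  exact: (span_gen _ (widen_ord (leqnSn i) j)).
apply/eqyP => A A0; apply: le_trans (len (Num.Def.archi_bound A)).
by rewrite lee_fin ltW //; exact: archi_boundP (ltW A0).
Qed.

Section Noetherian.
Variables (R : comNzRingType) (noethR : noetherian R).

Lemma noeth_fg_ideal (A : set R^o) : is_submod A -> fg_set A.
Proof.
move=> sA; have [s sP] := noethR (gen_submod A : submodClosed R^o).
exists (size s), (fun i => s`_i); split=> [i|a Aa].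
  apply/(mem_gen_submod _ sA); rewrite sP; apply/asboolP.
  exists 1%N, (fun=> 1), (fun=> s`_i); rewrite big_ord1 scale1r; split=> // _.
  exact: mem_nth.
by apply: gen_submod_seq; rewrite -sP; apply/(mem_gen_submod _ sA).
Qed.

(** Without a maximal member, choice gives a strictly increasing sequence in [F]; its union is
    finitely generated, hence reached at a finite stage. *)
Lemma noeth_max (F : set (set R^o)) :
  (exists A, F A) -> (forall A, F A -> is_submod A) ->
  exists A, F A /\ forall B, F B -> A `<=` B -> B `<=` A.
Proof.
move=> [A0 FA0] Fs; apply: contrapT => nmax.
have nextP (A : {A | F A}) : exists B : {A | F A},
    sval A `<=` sval B /\ exists x, sval B x /\ ~ sval A x.
  case: A => A FA; apply: contrapT => nB; apply: nmax; exists A; split=> // B FB leAB x Bx.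
  by apply: contrapT => nAx; apply: nB; exists (exist _ B FB); split=> //; exists x.
have [next nP] := choice nextP.
pose c n := sval (iter n next (exist _ A0 FA0)).
have Fc n : F (c n) by exact: svalP.
have cS n : c n `<=` c n.+1 by exact: (nP _).1.
have cle i j : (i <= j)%N -> c i `<=` c j.
  elim: j => [|j IH]; first by rewrite leqn0 => /eqP->.
  by rewrite leq_eqVlt => /predU1P[->//|/IH le]; exact: subset_trans (cS j).
pose U : set R^o := [set x | exists n, c n x].
have sU : is_submod U.
  split=> [|u v [i ci] [j cj]|a u [i ci]].
  - by exists 0%N; case: (Fs _ (Fc 0%N)).
  - exists (maxn i j); case: (Fs _ (Fc (maxn i j))) => _ D _.
    by apply: D; [apply: cle ci; rewrite leq_maxl | apply: cle cj; rewrite leq_maxr].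
  - by exists i; case: (Fs _ (Fc i)) => _ _; apply.
have [n [g [Ug sg]]] := noeth_fg_ideal sU.
have [h hP] := choice Ug.
pose N := \max_i h i.
have UN : U `<=` c N.
  apply: subset_trans sg _; apply: span_min => [|i]; first exact: Fs.
  by apply: cle (hP i); exact: leq_bigmax.
have [x [cx ncx]] := (nP (iter N next (exist _ A0 FA0))).2.
by apply: ncx; apply: UN; exists N.+1.
Qed.

(* By induction on [k] for submodules supported on the first [k] coordinates. *)
Lemma noeth_fg_rV b (S : set 'rV[R]_b) : is_submod S -> fg_set S.
Proof.
have key k : forall S : set 'rV[R]_b, is_submod S ->
    (forall v, S v -> forall j : 'I_b, (k <= j)%N -> v 0 j = 0) -> fg_set S.
  elim: k => {S} [|k IH] S sS Sk.
    exists 0%N, (fun=> 0); split=> [|v Sv]; first by case.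
    exists (fun=> 0); rewrite big_ord0; apply/rowP => j.
    by rewrite mxE (Sk v Sv).
  have [lt_kb|le_bk] := ltnP k b; last first.
    by apply: IH => // v Sv j; rewrite leqNgt (leq_trans (ltn_ord j) le_bk).
  pose jk := Ordinal lt_kb; have [S0 SD SZ] := sS.
  pose I : set R^o := [set a | exists v, S v /\ v 0 jk = a].
  have sI : is_submod I.
    split=> [|_ _ [u [Su <-]] [v [Sv <-]]|a _ [u [Su <-]]].
    - by exists 0; rewrite mxE.
    - by exists (u + v); rewrite mxE; split=> //; exact: SD.
    - by exists (a *: u); rewrite mxE; split=> //; exact: SZ.
  have [n [g [Ig sg]]] := noeth_fg_ideal sI.
  have [h hP] := choice Ig.
  (* Once the [k]-th coordinate of a vector is cancelled by lifts of generators of [I], what is left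
     lies in [S']. *)
  pose S' : set 'rV[R]_b := [set v | S v /\ v 0 jk = 0].
  have sS' : is_submod S'.
    split=> [|u v [Su u0] [Sv v0]|a u [Su u0]]; split=> //.
    - by rewrite mxE.
    - exact: SD.
    - by rewrite mxE u0 v0 addr0.
    - exact: SZ.
    - by rewrite mxE u0 mulr0.
  have S'k v : S' v -> forall j : 'I_b, (k <= j)%N -> v 0 j = 0.
    move=> [Sv v0] j; rewrite leq_eqVlt => /predU1P[ejk|]; last exact: Sk.
    by rewrite -v0; congr (v 0 _); apply: val_inj.
  have [n' [g' [S'g sg']]] := IH S' sS' S'k.
  exists (n + n')%N, (fun i => match fintype.split i with inl j => h j | inr j => g' j end).
  split=> [i|v Sv].
    by case: fintype.split => j; [case: (hP j) | case: (S'g j)].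
  have [c ec] : span g (v 0 jk) by apply: sg; exists v.
  have [c' ec'] : span g' (v - \sum_i c i *: h i).
    apply: sg'; split; first apply: is_submodB => //.
      by apply: is_submod_sum => // i _; apply: SZ; case: (hP i).
    rewrite !mxE summxE; apply/eqP; rewrite subr_eq0 ec; apply/eqP.
    by apply: eq_bigr => i _; rewrite mxE; case: (hP i) => _ ->.
  exists (fun i => match fintype.split i with inl j => c j | inr j => c' j end).
  rewrite big_split_ord /=.
  under eq_bigr => i _ do rewrite (unsplitK (inl i)).
  under [X in _ + X]eq_bigr => i _ do rewrite (unsplitK (inr i)).
  by rewrite -ec' addrCA subrr addr0.
move=> sS; apply: (key b) => // v _ j; by rewrite leqNgt ltn_ord.
Qed.

End Noetherian.

(** * Prime ideals in dimension one *)

Section PrimeIdeals.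
Variable R : comNzRingType.

Definition is_prime (A : set R^o) : Prop :=
  [/\ is_submod A, ~ A 1 & forall u v : R, A (u * v) -> A u \/ A v].

Lemma is_prime_exp (A : set R^o) (u : R) n : is_prime A -> A (u ^+ n) -> A u.
Proof.
case=> _ A1 AM; elim: n => [|n IH]; first by rewrite expr0.
by rewrite exprS => /AM[].
Qed.

Lemma is_submod_mull (A : set R^o) (a u : R) : is_submod A -> A u -> A (a * u).
Proof. by case=> _ _ /(_ a u). Qed.

Lemma idealr_of (A : set R^o) : is_submod A -> ~ A 1 ->
  exists I : idealr R, forall x, x \in I <-> A x.
Proof.
move=> sA A1; pose S : {pred R} := fun x => `[< A x >].
have cS : idealr_closed S.
  split; [by apply/asboolP; case: sA | by apply/asboolP |].
  move=> a u v /asboolP Au /asboolP Av; apply/asboolP.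
  by case: (sA) => _ AD _; apply: AD => //; exact: is_submod_mull.
pose I : idealr R := HB.pack S (isIdealr.Build R S cS).
by exists I => x; split=> /asboolP.
Qed.

Lemma prime_idealr_of (A : set R^o) : is_prime A ->
  exists I : prime_idealr R, forall x, x \in I <-> A x.
Proof.
move=> [sA A1 AM]; pose S : {pred R} := fun x => `[< A x >].
have cS : idealr_closed S.
  split; [by apply/asboolP; case: sA | by apply/asboolP |].
  move=> a u v /asboolP Au /asboolP Av; apply/asboolP.
  by case: (sA) => _ AD _; apply: AD => //; exact: is_submod_mull.
have pS : prime_idealr_closed S.
  by move=> u v /asboolP/AM[] H; apply/orP; [left|right]; apply/asboolP.
pose I : prime_idealr R :=
  HB.pack S (isIdealr.Build R S cS) (isPrimeIdealrClosed.Build R S pS).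
by exists I => x; split=> /asboolP.
Qed.

Lemma is_prime_mem (P : prime_idealr R) : is_prime [set x | x \in P].
Proof.
split=> [|/=|u v /=]; last by rewrite prime_idealrM => /orP.
  split=> /= [|u v|a u]; [exact: rpred0 | exact: rpredD | exact: idealMr].
by rewrite idealr1.
Qed.

Lemma is_submod_adjoin (A : set R^o) (u : R) : is_submod A ->
  is_submod [set x : R^o | exists p a, A p /\ x = p + a * u].
Proof.
move=> sA; have [A0 AD AZ] := sA; split.
- by exists 0, 0; split=> //; rewrite mul0r addr0.
- move=> _ _ [p [a [Ap ->]]] [q [b [Aq ->]]]; exists (p + q), (a + b).
  by split; [exact: AD | rewrite mulrDl addrACA].
- move=> c _ [p [a [Ap ->]]]; exists (c *: p), (c * a).
  by split; [exact: AZ | rewrite scalerDr; congr (_ + _); exact: mulrA].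
Qed.

Lemma is_submod0 : is_submod [set (0 : R^o)].
Proof.
split=> [//|u v -> ->|a u ->]; [exact: addr0 | exact: scaler0].
Qed.

Lemma is_submod_principal (y : R) : is_submod [set x : R^o | exists r : R, x = r * y].
Proof.
split=> [|_ _ [r ->] [s ->]|a _ [r ->]]; first by exists 0; rewrite mul0r.
  by exists (r + s); rewrite mulrDl.
by exists (a * r); rewrite -mulrA.
Qed.

Lemma mem_gen_principal (y u : R) :
  (u : R^o) \in gen_submod [set y : R^o] <-> exists r, u = r * y.
Proof.
split=> [/asboolP[n [c [g [gy ->]]]]|[r ->]].
  exists (\sum_i c i); rewrite mulr_suml; apply: eq_bigr => i _.
  by rewrite (gy i).
by apply/asboolP; exists 1%N, (fun=> r), (fun=> y); rewrite big_ord1.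
Qed.

Lemma quot_pi_eq0 (M : lmodType R) (S : submodClosed M) (v : M) :
  quot_pi S v = 0 <-> v \in S.
Proof.
by have := quot_piE S v 0; rewrite subr0 linear0 => <-; split=> /eqP.
Qed.

Lemma krull_dim_ge (RR : realType) (M : lmodType R) k (c : 'I_k -> set R^o) :
  (forall i, is_prime (c i)) ->
  (forall i (a : R), (forall x : M, a *: x = 0) -> c i a) ->
  (forall i j : 'I_k, (i < j)%N -> c i `<=` c j /\ exists x, c j x /\ ~ c i x) ->
  ((k%:R - 1)%:E <= krull_dim RR M)%E.
Proof.
move=> cp ca cc; have [d dP] := choice (fun i => prime_idealr_of (cp i)).
apply: ereal_sup_ubound; exists k => //; exists d; split=> [i a /ca ai|i j /cc[le [x [cj ci]]]].
  by apply/dP.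
split=> [y yi|H]; first by apply/dP/le/dP.
by apply/ci/dP/H/dP.
Qed.

Variable noethR : noetherian R.

(** An ideal [P] maximal among those containing [I] and missing [S] is prime: if [u] and [v] lie
    outside [P], then [P + (u)] and [P + (v)] meet [S], and the product of two such elements lies in
    [P] once [u * v] does. *)
Lemma prime_avoiding (S : set R) (I : set R^o) :
  S 1 -> (forall s t, S s -> S t -> S (s * t)) -> is_submod I ->
  (forall s, S s -> ~ I s) ->
  exists P, [/\ is_prime P, I `<=` P & forall s, S s -> ~ P s].
Proof.
move=> S1 SM sI SI.
pose F J := [/\ is_submod J, I `<=` J & forall s, S s -> ~ J s].
have [||P [[sP IP SP] Pmax]] := noeth_max noethR (F := F).
- by exists I; split.
- by move=> J [].
have big u : ~ P u -> exists p (a : R), P p /\ S (p + a * u).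
  move=> nPu; apply: contrapT => nex; apply: nPu.
  pose J := [set x : R^o | exists p a, P p /\ x = p + a * u].
  have sJ : is_submod J by exact: is_submod_adjoin.
  have PJ : P `<=` J by move=> x Px; exists x, 0; rewrite mul0r addr0.
  apply: (Pmax J _ PJ); last first.
    by exists 0, 1; rewrite mul1r add0r; split=> //; case: sP.
  split=> //; first exact: subset_trans PJ.
  by move=> s Ss [p [a [Pp es]]]; apply: nex; exists p, a; rewrite -es.
exists P; split=> //; split=> //; first exact: SP.
move=> u v Puv; apply: contrapT => /not_orP[/big[p [a [Pp Su]]] /big[q [b [Pq Sv]]]].
apply: (SP _ (SM _ _ Su Sv)).
have -> : (p + a * u) * (q + b * v) = (q + b * v) * p + (a * u * q + a * b * (u * v)).
  by ring.
case: (sP) => _ PD _; apply: (PD); first exact: is_submod_mull.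
by apply: (PD); exact: is_submod_mull.
Qed.

(** The second hypothesis says that [x] is not nilpotent in the localization at [Q]. The prime is
    found by avoiding all products [t * x ^+ k] with [t] outside [Q]. *)
Lemma prime_below (Q : set R^o) (x : R) :
  is_prime Q -> (forall t k, t * x ^+ k = 0 -> Q t) ->
  exists P, [/\ is_prime P, P `<=` Q & ~ P x].
Proof.
move=> [sQ Q1 QM] Qx.
have [||||P [pP _ SP]] := @prime_avoiding
   [set s | exists t k, ~ Q t /\ s = t * x ^+ k] [set 0].
- by exists 1, 0%N; rewrite mulr1.
- move=> _ _ [t [k [nt ->]]] [t' [k' [nt' ->]]]; exists (t * t'), (k + k')%N.
  by rewrite exprD mulrACA; split=> // /QM[].
- exact: is_submod0.
- by move=> s [t [k [nt ->]]] /Qx.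
exists P; split=> // [z Pz|]; last by apply: SP; exists 1, 1%N; rewrite mul1r.
by apply: contrapT => nQ; apply: (SP z) => //; exists z, 0%N; rewrite mulr1.
Qed.

End PrimeIdeals.

Section LocalRing.
Variables (R : comNzRingType) (m : idealr R).
Hypotheses (noethR : noetherian R) (localR : local_ring m).

Lemma is_submod_m : is_submod ([set x | x \in m] : set R^o).
Proof.
by split=> /= [|u v|a u]; [exact: rpred0 | exact: rpredD | exact: idealMr].
Qed.

(** If [x] is not invertible, an ideal maximal among the proper ones containing [x] is a maximal
    ideal, hence equal to [m]. *)
Lemma local_unit x : x \notin m -> exists y, y * x = 1.
Proof.
move=> xm; apply: contrapT => nux; move/negP: xm; apply.
pose F (J : set R^o) := [/\ is_submod J, J x & ~ J 1].
have [||A [[sA Ax A1] Amax]] := noeth_max noethR (F := F).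
- exists [set z : R^o | exists r : R, z = r * x]; split; first exact: is_submod_principal.
    by exists 1; rewrite mul1r.
  by move=> [r er]; apply: nux; exists r.
- by move=> J [].
have [I IP] := idealr_of sA A1.
have maxI : maximal_ideal I.
  move=> J le_IJ z; apply/idP/idP; last exact: le_IJ.
  move=> Jz; apply/IP; apply: (Amax [set z | z \in J]) => //=.
    split=> /=; [|by apply/le_IJ/IP | by rewrite idealr1].
    by split=> /= [|u v|a u]; [exact: rpred0 | exact: rpredD | exact: idealMr].
  by move=> w /IP/le_IJ.
by rewrite -(localR.2 _ maxI); apply/IP.
Qed.

Lemma is_prime_m : is_prime ([set x | x \in m] : set R^o).
Proof.
split=> /=; [exact: is_submod_m | by rewrite idealr1 | move=> u v uvm].
have [um|/local_unit[y yu]] := boolP (u \in m); [by left | right].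
by rewrite -[v]mul1r -yu -mulrA; exact: idealMr.
Qed.

Lemma local_sub_m (A : set R^o) : is_submod A -> ~ A 1 -> A `<=` [set x | x \in m].
Proof.
move=> sA A1 x Ax /=; apply: contrapT => /negP/local_unit[y yx].
by apply: A1; rewrite -yx; exact: is_submod_mull.
Qed.

(** This says that [m] is contained in the radical of [(x)]. *)
Definition rad_m (x : R) := forall P, is_prime P -> P x -> [set z | z \in m] `<=` P.

Lemma rad_m_exp x u : rad_m x -> u \in m -> exists n r, u ^+ n = r * x.
Proof.
move=> rx um; apply: contrapT => nex.
have [||||P [pP IP SP]] := @prime_avoiding _ noethR [set s | exists n, s = u ^+ n]
    [set z | exists r, z = r * x].
- by exists 0%N.
- by move=> _ _ [i ->] [j ->]; exists (i + j)%N; rewrite exprD.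
- exact: is_submod_principal.
- by move=> _ [n ->] [r er]; apply: nex; exists n, r.
apply: (SP u); first by exists 1%N.
by apply: (rx P pP _ u) => //; apply: IP; exists 1; rewrite mul1r.
Qed.

(* An element [x] satisfying [good] behaves, up to one extra factor [x], like a regular
   parameter, although [R] need not be Cohen-Macaulay. *)
Definition good (x : R) : Prop :=
  [/\ x \in m, forall u, u \in m -> exists n r, u ^+ n = r * x,
      forall z, x * (x * z) = 0 -> x * z = 0 & x != 0].

Section DimensionOne.
Variable RR : realType.
Hypothesis dimR : krull_dim RR (R^o : lmodType R) = 1%E.

(** Otherwise [P], [Q] and [m] form a strict chain of three primes and the dimension is at least
    two; [z] shows that [Q] differs from [m]. *)
Lemma dim1_minimal (P Q : set R^o) z :
  is_prime P -> is_prime Q -> P `<=` Q -> z \in m -> ~ Q z -> Q `<=` P.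
Proof.
move=> pP pQ lePQ zm nQz x Qx; apply: contrapT => nPx.
pose c (i : 'I_3) : set R^o := nth setT [:: P; Q; [set x | x \in m]] i.
have Qm : Q `<=` [set x | x \in m] by apply: local_sub_m; case: pQ.
have : ((3%:R - 1)%:E <= krull_dim RR (R^o : lmodType R))%E.
  apply: (@krull_dim_ge _ _ _ _ c) => [|i a a0|].
  - by case=> [[|[|[|//]]] ?] //; exact: is_prime_m.
  - suff -> : a = 0 by case: i => [[|[|[|//]]] ?]; [case: pP => -[] | case: pQ => -[] |
      rewrite /c /=; exact: rpred0].
    by rewrite -[a]mulr1; exact: (a0 1).
  - case=> [[|[|[|//]]] ?] [[|[|[|//]]] ?] //= _; split=> //; rewrite /c /=.
    + by exists x.
    + by exact: subset_trans Qm.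
    + by exists z; split=> // /lePQ.
    + by exists z.
by rewrite dimR lee_fin; lra.
Qed.

(** Positive dimension forces a strict chain of two primes; the lower one misses an element of the
    upper one, which lies in [m]. *)
Lemma dim1_prime : exists (P : set R^o) z, [/\ is_prime P, z \in m & ~ P z].
Proof.
apply: contrapT => nex.
suff : (krull_dim RR (R^o : lmodType R) <= 0)%E by rewrite dimR lee_fin ler10.
apply: ge_ereal_sup => _ [[|[|k]] ck <-]; rewrite lee_fin; [lra | lra |].
case: ck => c [_ cc]; case: nex.
have [_ lt01] := cc (Ordinal (erefl : 0 < k.+2)%N) (Ordinal (erefl : 1 < k.+2)%N) erefl.
have [z [z1 z0]] : exists z, z \in c (Ordinal (erefl : 1 < k.+2)%N) /\
    ~ z \in c (Ordinal (erefl : 0 < k.+2)%N).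
  apply: contrapT => nz; apply: lt01 => z z1; apply: contrapT => z0.
  by apply: nz; exists z.
exists [set x | x \in c (Ordinal (erefl : 0 < k.+2)%N)], z; split=> //.
  exact: is_prime_mem.
have [sc nc1 _] := is_prime_mem (c (Ordinal (erefl : 1 < k.+2)%N)).
exact: (local_sub_m sc nc1 z1).
Qed.

(** A prime [Q] other than [m] is minimal, so its elements are nilpotent in the localization at
    [Q]. *)
Lemma dim1_annihilated (Q : set R^o) z x :
  is_prime Q -> z \in m -> ~ Q z -> Q x -> exists t k, ~ Q t /\ t * x ^+ k = 0.
Proof.
move=> pQ zm nQz Qx; apply: contrapT => nex.
have [|P [pP lePQ nPx]] := @prime_below _ noethR Q x pQ.
  by move=> t k tx; apply: contrapT => nQt; apply: nex; exists t, k.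
by apply: nPx; exact: (dim1_minimal pP pQ lePQ zm nQz).
Qed.

(** From [t * x ^+ k = 0] with [t] outside a prime, a regular [x] cancels and leaves [t = 0]. *)
Lemma rad_m_regular x : x \in m -> (forall y, x * y = 0 -> y = 0) -> rad_m x.
Proof.
move=> xm rx P pP Px z zm; apply: contrapT => nPz.
have [t [k [nPt tx]]] := dim1_annihilated pP zm nPz Px.
apply: nPt; suff -> : t = 0 by case: pP => -[].
elim: k tx => [|k IH]; first by rewrite mulr1.
by rewrite exprS mulrCA => /rx.
Qed.

(* A principal radical maximal among those of elements of [m] is [m]: a prime [Q] containing
   [x] but not [m] is minimal, so [t * x ^+ k = 0] for some [t \notin Q], which may be taken
   in [m], and the radical of [x ^+ k.+1 + t] is strictly larger. *)
Lemma exists_rad_m : exists x, x \in m /\ rad_m x.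
Proof.
pose rad (x : R) : set R^o := [set z | forall P, is_prime P -> P x -> P z].
pose F (A : set R^o) := exists x, x \in m /\ A = rad x.
have [||_ [[x [xm ->]] xmax]] := noeth_max noethR (F := F).
- by exists (rad 0), 0; split=> //; exact: rpred0.
- move=> _ [x [_ ->]]; split=> [P [[]] //|u v ru rv P pP Px|a u ru P pP Px].
    by case: (pP) => -[_ PD _] _ _; apply: PD; [exact: ru | exact: rv].
  by apply: is_submod_mull; [case: pP | exact: ru].
exists x; split=> // Q pQ Qx z zm; apply: contrapT => nQz.
have [t [k [nQt tx]]] := dim1_annihilated pQ zm nQz Qx.
have nQtz : ~ Q (t * z) by case: (pQ) => _ _ QM /QM[].
have tzm : t * z \in m by exact: idealMr.
have txz : x ^+ k.+1 * (t * z) = 0.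
  have -> : x ^+ k.+1 * (t * z) = x * z * (t * x ^+ k) by rewrite exprS; ring.
  by rewrite tx mulr0.
pose x' := x ^+ k.+1 + t * z.
have x'm : x' \in m by apply: rpredD => //; rewrite exprSr; exact: idealMr.
(* Since [x ^+ k.+1] kills [t * z], its product with [x'] is [x ^+ (k.+1 + k.+1)]. *)
have Px' P : is_prime P -> P x' -> P x.
  move=> pP Px'; apply: (@is_prime_exp _ _ _ (k.+1 + k.+1)%N pP).
  rewrite exprD -[X in P X]addr0 -[in X in P X]txz -mulrDr.
  by apply: is_submod_mull; case: pP.
have le : rad x' `<=` rad x.
  by apply: xmax; [exists x' | move=> w rw P pP /(Px' _ pP) /rw; apply].
apply: nQtz; apply: (le (t * z) _ Q pQ Qx) => P pP Px'x.
have -> : t * z = x' - x * x ^+ k by rewrite /x' exprS addrC addKr.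
have sP : is_submod P by case: pP.
apply: (is_submodB sP) => //; rewrite mulrC; apply: (is_submod_mull _ sP).
exact: Px'.
Qed.

(** The annihilators of the powers of [x] become stationary, which gives the cancellation property.
    No power of [x] vanishes, since otherwise [m] would lie in every prime. *)
Lemma rad_m_good x : x \in m -> rad_m x -> exists N, good (x ^+ N.+1).
Proof.
move=> xm rx.
pose ann (y : R) : set R^o := [set z | y * z = 0].
pose F (A : set R^o) := exists n, A = ann (x ^+ n.+1).
have [||_ [[n ->] nmax]] := noeth_max noethR (F := F).
- by exists (ann (x ^+ 1)), 0%N.
- move=> _ [n ->]; split=> [|u v|a u] /=; rewrite /ann /=; first by rewrite mulr0.
    by rewrite mulrDr => -> ->; rewrite addr0.
  by move=> xu; rewrite -[a *: u]/(a * u) mulrCA xu mulr0.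
exists n; split.
- by rewrite exprSr; exact: idealMr.
- move=> u um; have [k [r uk]] := rad_m_exp rx um.
  by exists (k * n.+1)%N, (r ^+ n.+1); rewrite exprM uk exprMn.
(* The exponent is twice [n.+1]: the maximal annihilator is compared with that of the square. *)
- move=> z xxz; apply: (nmax (ann (x ^+ (n + n.+1).+1))).
  + by exists (n + n.+1)%N.
  + by move=> w; rewrite /ann /= -addSn exprD -mulrA => ->; rewrite mulr0.
  + by rewrite /ann /= -addSn exprD -mulrA.
- have [P [z [pP zm nPz]]] := dim1_prime.
  apply/eqP => x0; apply: nPz; apply: (rx P pP _ z zm).
  by apply: (@is_prime_exp _ _ _ n.+1 pP); rewrite x0; case: pP => -[].
Qed.

(** As [R/(x)] has annihilator [(x)] and dimension [0] rather than [-1], some prime contains [x]; a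
    prime other than [m] containing [x] would give a chain of two primes, hence dimension at least
    [1]. *)
Lemma parameter_rad_m x : parameter RR x -> x \in m /\ rad_m x.
Proof.
rewrite /parameter dimR => dimx; set M := ring_quot [set x] in dimx.
have dim0 : krull_dim RR M = 0%E by rewrite dimx -EFinB subrr.
have annP (a : R) : (forall v : M, a *: v = 0) <-> exists r, a = r * x.
  split=> [/(_ (quot_pi _ 1))|[r ->] v].
    rewrite -linearZ => /quot_pi_eq0/mem_gen_principal[r].
    by rewrite -[a *: 1]/(a * 1) mulr1; exists r.
  rewrite -[v]quot_piK -linearZ.
  apply/quot_pi_eq0/mem_gen_principal; exists (r * repr v).
  by rewrite -[X in X = _]/(r * x * repr v) mulrAC.
have [Q [pQ Qx]] : exists Q : set R^o, is_prime Q /\ Q x.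
  apply: contrapT => nex.
  suff : (krull_dim RR M <= (-1)%:E)%E by rewrite dim0 lee_fin; lra.
  apply: ge_ereal_sup => _ [[|k] ck <-]; rewrite lee_fin; [lra | case: nex].
  case: ck => c [ca _]; exists [set z | z \in c ord0]; split; first exact: is_prime_mem.
  by apply: ca; apply/annP; exists 1; rewrite mul1r.
have xm : x \in m by apply: (local_sub_m _ _ Qx); case: pQ.
split=> // P pP Px z zm; apply: contrapT => nPz.
pose c (i : 'I_2) : set R^o := nth setT [:: P; [set x | x \in m]] i.
have : ((2%:R - 1)%:E <= krull_dim RR M)%E.
  apply: (@krull_dim_ge _ _ _ _ c) => [|i a /annP[r ->]|].
  - by case=> [[|[|//]] ?] //; exact: is_prime_m.
  - by case: i => [[|[|//]] ?]; rewrite /c /=; [apply: is_submod_mull => //; case: pP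
      | exact: idealMr].
  - case=> [[|[|//]] ?] [[|[|//]] ?] //= _; rewrite /c /=; split; last by exists z.
    by apply: local_sub_m; case: pP.
by rewrite dim0 lee_fin; lra.
Qed.

End DimensionOne.
End LocalRing.

(** * Nakayama's lemma and independence over the Frobenius *)

Section RowCombination.
Variables (R : comNzRingType) (V : lmodType R) (n : nat) (g : 'I_n -> V).

Definition row_comb (u : 'rV[R]_n) : V := \sum_i u 0 i *: g i.

Lemma row_comb_linear : linear row_comb.
Proof.
move=> a u v; rewrite /row_comb scaler_sumr -big_split; apply: eq_bigr => i _ /=.
by rewrite !mxE scalerDl scalerA.
Qed.
HB.instance Definition _ := GRing.isLinear.Build R 'rV[R]_n V *:%R row_comb row_comb_linear.
End RowCombination.

Lemma linear_rowE (R : comNzRingType) (V : lmodType R) n (f : {linear 'rV[R]_n -> V}) u :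
  f u = \sum_i u 0 i *: f (delta_mx 0 i).
Proof.
by rewrite {1}[u]row_sum_delta linear_sum; apply: eq_bigr => i _; rewrite linearZ.
Qed.

Section Nakayama.
Variables (R : comNzRingType) (m : idealr R).
Hypotheses (noethR : noetherian R) (localR : local_ring m).

(** With [b] the least number of generators, a relation with a unit coefficient would make one
    generator redundant. *)
Lemma fg_min_cover (V : lmodType R) : fg V ->
  exists b (f : {linear 'rV[R]_b -> V}),
    (forall v, exists u, f u = v) /\ (forall u, f u = 0 -> forall j, u 0 j \in m).
Proof.
move=> [n0 [g0 [_ sg0]]].
pose P n := `[< exists g : 'I_n -> V, forall v, span g v >].
have exP : exists n, P n by exists n0; apply/asboolP; exists g0 => v; apply: sg0.
case: (ex_minnP exP) => b /asboolP[g sg] bmin.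
exists b, (row_comb g); split=> [v|u u0 j].
  have [c ->] := sg v; exists (\row_i c i).
  by apply: eq_bigr => i _; rewrite mxE.
apply: contrapT => /negP/(local_unit noethR localR)[y yu].
case: b g sg bmin u u0 j yu => [|b] g sg bmin u u0 j yu; first by case: j yu.
suff : P b by move/bmin; rewrite ltnn.
apply/asboolP; exists (fun i => g (lift j i)) => v.
apply: (span_min (is_submod_span _) _ (sg v)) => i.
have [k ->|->] := unliftP j i; first exact: (span_gen (fun i => g (lift j i))).
exists (fun k => - (y * u 0 (lift j k))); apply/eqP.
rewrite -[X in X == _]scale1r -yu -scalerA -subr_eq0; apply/eqP.
transitivity (y *: row_comb g u); last by rewrite u0 scaler0.
rewrite /row_comb (bigD1_ord j) //= scalerDr; congr (_ + _).
rewrite scaler_sumr -sumrN; apply: eq_bigr => k _.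
by rewrite scaleNr opprK scalerA.
Qed.

(** Modulo [m] the matrix [1%:M - C] becomes the identity. *)
Lemma det_1_sub n (C : 'M[R]_n) : (forall i j, C i j \in m) -> \det (1%:M - C) \notin m.
Proof.
move=> Cm; pose f : {rmorphism R -> {ideal_quot m}} := \pi_{ideal_quot m}%qT.
have f0 x : (f x == 0) = (x \in m).
  by rewrite -(rmorph0 f) -[RHS](congr1 _ (subr0 x)) -(Quotient.idealrBE m).
rewrite -f0 -det_map_mx map_mxB map_mx1.
suff -> : map_mx f C = 0 by rewrite subr0 det1 oner_eq0.
by apply/matrixP => i j; rewrite !mxE; apply/eqP; rewrite f0.
Qed.

(** The determinant trick: multiplying the relations by the adjugate of [1%:M - C] shows that its
    determinant, a unit, kills every [g k]. *)
Lemma nakayama (V : lmodType R) n (g : 'I_n -> V) (C : 'M[R]_n) :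
  (forall i j, C i j \in m) -> (forall i, g i = \sum_j C i j *: g j) ->
  forall i, g i = 0.
Proof.
move=> Cm gC k; set A := 1%:M - C.
have gA i : \sum_j A i j *: g j = 0.
  transitivity (\sum_j (1%:M i j *: g j - C i j *: g j)).
    by apply: eq_bigr => j _; rewrite !mxE scalerBl.
  rewrite sumrB -gC (bigD1 i) //= mxE eqxx scale1r big1 ?addr0 ?subrr // => j ji.
  by rewrite mxE eq_sym (negPf ji) scale0r.
have dg : \det A *: g k = 0.
  transitivity (\sum_j (\det A)%:M k j *: g j).
    rewrite (bigD1 k) //= mxE eqxx mulr1n big1 ?addr0 // => j jk.
    by rewrite mxE eq_sym (negPf jk) mulr0n scale0r.
  rewrite -mul_adj_mx; transitivity (\sum_i \adj A k i *: \sum_j A i j *: g j).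
    under eq_bigr => j _ do rewrite mxE scaler_suml.
    rewrite exchange_big; apply: eq_bigr => i _; rewrite scaler_sumr.
    by apply: eq_bigr => j _; rewrite scalerA.
  by rewrite big1 // => i _; rewrite gA scaler0.
have [y yd] := local_unit noethR localR (det_1_sub Cm).
by rewrite -[g k]scale1r -yd -scalerA dg scaler0.
Qed.

Definition span_m (V : lmodType R) n (g : 'I_n -> V) : set V :=
  [set v | exists c : 'I_n -> R, (forall i, c i \in m) /\ v = \sum_i c i *: g i].

Lemma is_submod_span_m (V : lmodType R) n (g : 'I_n -> V) : is_submod (span_m g).
Proof.
split=> [|_ _ [c [cm ->]] [d [dm ->]]|a _ [c [cm ->]]].
- by exists (fun=> 0); split=> [i|]; [exact: rpred0 | rewrite big1 // => i _; rewrite scale0r].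
- exists (fun i => c i + d i); split=> [i|]; first exact: rpredD.
  by rewrite -big_split; apply: eq_bigr => i _; rewrite scalerDl.
- exists (fun i => a * c i); split=> [i|]; first exact: idealMr.
  by rewrite scaler_sumr; apply: eq_bigr => i _; rewrite scalerA.
Qed.

Lemma span_mZ (V : lmodType R) n (g : 'I_n -> V) a v :
  a \in m -> span g v -> span_m g (a *: v).
Proof.
move=> am [c ->]; exists (fun i => a * c i); split=> [i|].
  by rewrite mulrC; exact: idealMr.
by rewrite scaler_sumr; apply: eq_bigr => i _; rewrite scalerA.
Qed.

Lemma span_m_sub (V : lmodType R) n (g : 'I_n -> V) : span_m g `<=` span g.
Proof. by move=> _ [c [_ ->]]; exists c. Qed.

(** If every [a *: g i] lay in [a] times [span_m g], then Nakayama's lemma for the family [a *: g i]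
    would make all of it zero. *)
Lemma nakayama_scale (V : lmodType R) n (g : 'I_n -> V) a :
  (exists i, a *: g i != 0) ->
  exists i, forall u, span_m g u -> a *: g i <> a *: u.
Proof.
move=> [k]; apply: contra_neqP => nex.
have ex i : exists u, span_m g u /\ a *: g i = a *: u.
  apply: contrapT => nu; apply: nex; exists i => u gu au.
  by apply: nu; exists u.
have [u uP] := choice ex; have [c cP] := choice (fun i => (uP i).1).
apply: (nakayama (g := fun i => a *: g i) (C := \matrix_(i, j) c i j)) => [i j|i].
  by rewrite mxE; exact: (cP i).1.
rewrite (uP i).2 (cP i).2 scaler_sumr; apply: eq_bigr => j _.
by rewrite mxE !scalerA mulrC.
Qed.

End Nakayama.

Section FrobeniusPower.
Variables (R : comNzRingType) (p : nat) (charRp : p \in [pchar R]) (e : nat).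

(** The characteristic hypothesis is an argument so that the map can carry a ring morphism
    structure. *)
Definition frob_pow of p \in [pchar R] := fun x : R => x ^+ (p ^ e).
Local Notation F := (frob_pow charRp).

Lemma frob_pow_is_zmod_morphism : zmod_morphism F.
Proof.
move=> x y; rewrite /frob_pow; apply/eqP; rewrite eq_sym subr_eq -exprDn_pchar ?subrK //.
by rewrite pnatX pnatE ?charRp ?(pcharf_prime charRp).
Qed.
Lemma frob_pow_is_monoid_morphism : monoid_morphism F.
Proof. by split=> [|x y]; rewrite /frob_pow ?expr1n ?exprMn. Qed.
HB.instance Definition _ := GRing.isZmodMorphism.Build R R F frob_pow_is_zmod_morphism.
HB.instance Definition _ := GRing.isMonoidMorphism.Build R R F frob_pow_is_monoid_morphism.
End FrobeniusPower.

Section FrobeniusBasis.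
Variables (R : comNzRingType) (m : idealr R).
Hypotheses (noethR : noetherian R) (localR : local_ring m).
Variables (p : nat) (charRp : p \in [pchar R]).

(** Linear independence of the residues of the [u i] over [K^q], stated in [R]: a [q]-th power lies
    in [m] exactly when its root does. *)
Definition frob_indep e (I : finType) (u : I -> R) : Prop :=
  forall c : I -> R, \sum_i frob_pow e charRp (c i) * u i \in m -> forall i, c i \in m.

Lemma frob_indep0 e : frob_indep e (fun=> 1 : R) (I := unit).
Proof.
move=> c; rewrite (big_pred1 tt) => [|[]//]; rewrite mulr1 => /= cm [].
exact: (is_prime_exp (is_prime_m noethR localR) cm).
Qed.

(** The tower of [K] over [K^p] over [K^(pq)]: the sum over pairs regroups as a sum over [j] of
    [v j] times the [p]-th power of a sum over [i]. *)
Lemma frob_indepS e (I J : finType) (u : I -> R) (v : J -> R) :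
  frob_indep e u -> frob_indep 1 v ->
  frob_indep e.+1 (fun k : I * J => frob_pow 1 charRp (u k.1) * v k.2).
Proof.
move=> iu iv c cm [i j]; apply: (iu (fun i => c (i, j))).
move: j; apply: iv; congr (_ \in m): cm; symmetry.
transitivity (\sum_j \sum_i frob_pow e.+1 charRp (c (i, j)) * (frob_pow 1 charRp (u i) * v j)).
  apply: eq_bigr => j _; rewrite rmorph_sum mulr_suml; apply: eq_bigr => k _.
  by rewrite rmorphM /= mulrA /frob_pow -exprM -expnD addn1.
by rewrite exchange_big pair_bigA; apply: eq_bigr => -[].
Qed.

Lemma frob_indep_basis n :
  frob_basis (residue_field m) p n -> exists u : 'I_n -> R, frob_indep 1 u.
Proof.
move=> [b bP]; pose f : {rmorphism R -> {ideal_quot m}} := \pi_{ideal_quot m}%qT.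
have f0 x : (f x == 0) = (x \in m).
  by rewrite -(rmorph0 f) -[RHS](congr1 _ (subr0 x)) -(Quotient.idealrBE m).
have fK (x : {ideal_quot m}) : f (repr x) = x by exact: reprK.
exists (fun i => repr (b i)) => c cm i.
(* The zero family and the [p]-th powers of the residues of the [c i] both expand [0], so uniqueness
   identifies them. *)
have [d [_ dU]] := bP 0.
have p0 : (0 < p)%N by exact: prime_gt0 (pcharf_prime charRp).
have c0 : d = (fun i => f (c i) ^+ p).
  apply: dU; split=> [j|]; first by exists (f (c j)).
  have s0 : \sum_j f (frob_pow 1 charRp (c j) * repr (b j)) = 0.
    by rewrite -rmorph_sum; apply/eqP; rewrite f0.
  apply: etrans (esym s0) _.
  by apply: eq_bigr => j _; rewrite rmorphM /= fK /frob_pow rmorphXn expn1.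
have d0 : d = (fun=> 0).
  apply: dU; split=> [j|]; first by exists 0; rewrite expr0n gtn_eqF.
  by rewrite big1 // => j _; rewrite mul0r.
have /(congr1 (@^~ i)) := etrans (esym c0) d0; rewrite /= -rmorphXn => /eqP.
by rewrite f0 => /(is_prime_exp (is_prime_m noethR localR)).
Qed.

Lemma exists_frob_indep n e : frob_basis (residue_field m) p n ->
  exists (I : finType) (u : I -> R), #|I| = (n ^ e)%N /\ frob_indep e u.
Proof.
move=> /frob_indep_basis[v iv]; elim: e => [|e [I [u [cI iu]]]].
  by exists unit, (fun=> 1); rewrite card_unit; split=> //; exact: frob_indep0.
exists (I * 'I_n)%type; eexists; split; last exact: frob_indepS iu iv.
by rewrite card_prod cI card_ord expnSr.
Qed.

(* When the residue field has no finite [p]-basis, [frob_degree] and hence [alpha] are [0]. *)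
Lemma exists_frob_indep_alpha (RR : realType) e :
  exists (I : finType) (u : I -> R), [/\ (0 < #|I|)%N, frob_indep e u &
    (p ^ e)%:R `^ (1 + alpha RR p m) = (p ^ e)%:R * #|I|%:R :> RR].
Proof.
have pp := pcharf_prime charRp.
have p0 : (0 : RR) < p%:R by rewrite ltr0n prime_gt0.
have pe0 : (p ^ e)%:R != 0 :> RR by rewrite pnatr_eq0 -lt0n expn_gt0 prime_gt0.
rewrite powRD ?pe0 ?implybT // powRr1 ?ler0n // /alpha.
rewrite /frob_degree; case: xgetP => [n _ nP|_].
  have [I [u [cI iu]]] := exists_frob_indep e nP.
  exists I, u; rewrite cI.
  (* An empty basis could not represent [1]. *)
  have n0 : (0 < n)%N.
    case: n nP {cI} => // -[b /(_ 1)[c [[_ /eqP]]]].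
    by rewrite big_ord0 oner_eq0.
  rewrite expn_gt0 n0; split=> //; congr (_ * _).
  rewrite /powR (negPf pe0) natrX lnXn // mulrnAr -mulrA mulVf ?mulr1; last first.
    by rewrite gt_eqF // ln_gt0 // ltr1n prime_gt1.
  by rewrite -mulr_natr expRM_natr lnK ?posrE ?ltr0n // natrX.
exists unit, (fun=> 1); rewrite card_unit; split=> //; first exact: frob_indep0.
by rewrite ln0 // mul0r powRr0.
Qed.

End FrobeniusBasis.

(** * Comparison of resolutions *)

(** The chain stays strict in homology: elements of equal class differ by an element of the image of
    [f], which lies in every [c i]. *)
Lemma mod_length_homology_ge (RR : realType) (R : comNzRingType) (A B C : lmodType R)
    (f : {linear A -> B}) (g : {linear B -> C}) (c : nat -> set B) n :
  (forall i, (i <= n)%N ->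
     [/\ is_submod (c i), forall x, c i (f x) & forall y, c i y -> g y = 0]) ->
  (forall i, (i < n)%N -> c i `<=` c i.+1 /\ exists v, c i.+1 v /\ ~ c i v) ->
  (n%:R%:E <= mod_length RR (homology f g))%E.
Proof.
move=> cP cc; pose d i : set (homology f g) :=
  [set h | exists z : submod_type (lin_ker g), c i (val z) /\ h = quot_pi _ z].
apply: (@mod_length_ge _ _ _ d) => [i le_in|i lt_in].
  have [[c0 cD cZ] cf cg] := cP i le_in.
  split=> [|_ _ [z [cz ->]] [w [cw ->]]|a _ [z [cz ->]]].
  - by exists 0; rewrite !linear0.
  - by exists (z + w); rewrite !linearD; split=> //; exact: cD.
  - by exists (a *: z); rewrite !linearZ; split=> //; exact: cZ.
have [le_c [v [cv ncv]]] := cc i lt_in.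
have [sc cf cg] := cP i (ltnW lt_in).
split=> [_ [z [/le_c cz ->]]|]; first by exists z.
have [_ _ /(_ v cv) gv] := cP i.+1 lt_in.
have kv : v \in lin_ker g by rewrite unfold_in gv.
pose y : submod_type (lin_ker g) := exist _ v kv.
exists (quot_pi _ y); split; first by exists y.
move=> [z [cz /eqP]]; rewrite quot_piE => /asboolP[x /= fx]; apply: ncv.
rewrite -[v](subrK (val z)); case: (sc) => _ cD _; apply: cD => //.
by rewrite (_ : v - val z = f x).
Qed.

Lemma is_submod_ker_preim (R : pzRingType) (V W X : lmodType R) (f : {linear V -> W})
    (g : {linear V -> X}) (A : set X) :
  is_submod A -> is_submod [set t | f t = 0 /\ A (g t)].
Proof.
move=> [A0 AD AZ]; split=> [|u v [u0 Au] [v0 Av]|a u [u0 Au]]; split.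
- exact: linear0.
- by rewrite linear0.
- by rewrite linearD u0 v0 addr0.
- by rewrite linearD; exact: AD.
- by rewrite linearZ /= u0 scaler0.
- by rewrite linearZ; exact: AZ.
Qed.

(** * Tensor products and their universal property *)

Section TensorProduct.
Variables (R : comNzRingType) (M N : lmodType R).

Lemma tensor_rel0 w : tensor_rel w -> quot_pi (gen_submod (@tensor_rel _ M N)) w = 0.
Proof.
move=> rw; apply/eqP; rewrite -(linear0 (quot_pi _)) quot_piE subr0.
apply/asboolP; exists 1%N, (fun=> 1), (fun=> w).
by rewrite big_ord1 scale1r.
Qed.

Lemma tensDl (x x' : M) (y : N) : tens (x + x') y = tens x y + tens x' y.
Proof.
apply/eqP; rewrite [X in _ == X]addrC -subr_eq -subr_eq0; apply/eqP.
rewrite -[RHS](tensor_rel0 (w := pure_sym (x + x') y - pure_sym x y - pure_sym x' y)).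
  by rewrite !linearB.
by left; left; left; exists (x, x', y).
Qed.

Lemma tensDr (x : M) (y y' : N) : tens x (y + y') = tens x y + tens x y'.
Proof.
apply/eqP; rewrite [X in _ == X]addrC -subr_eq -subr_eq0; apply/eqP.
rewrite -[RHS](tensor_rel0 (w := pure_sym x (y + y') - pure_sym x y - pure_sym x y')).
  by rewrite !linearB.
by left; left; right; exists (x, (y, y')).
Qed.

Lemma tensZl a (x : M) (y : N) : tens (a *: x) y = a *: tens x y.
Proof.
apply/eqP; rewrite -subr_eq0; apply/eqP.
rewrite -[RHS](tensor_rel0 (w := pure_sym (a *: x) y - a *: pure_sym x y)).
  by rewrite [RHS]linearB [X in _ = _ - X]linearZ.
by left; right; exists (a, (x, y)).
Qed.

Lemma tensZr a (x : M) (y : N) : tens x (a *: y) = a *: tens x y.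
Proof.
apply/eqP; rewrite -subr_eq0; apply/eqP.
rewrite -[RHS](tensor_rel0 (w := pure_sym x (a *: y) - a *: pure_sym x y)).
  by rewrite [RHS]linearB [X in _ = _ - X]linearZ.
by right; exists (a, (x, y)).
Qed.

Lemma tens_sumr (x : M) (I : finType) (y : I -> N) :
  tens x (\sum_i y i) = \sum_i tens x (y i).
Proof.
apply: (big_morph (tens x)); first exact: tensDr.
by rewrite -(scale0r 0) tensZr scale0r.
Qed.

Lemma tens_suml (I : finType) (x : I -> M) (y : N) :
  tens (\sum_i x i) y = \sum_i tens (x i) y.
Proof.
apply: (big_morph (fun x : M => tens x y)) => [u v|]; first exact: tensDl.
by rewrite -(scale0r 0) tensZl scale0r.
Qed.

Lemma tensor_ind (P : set (tensor M N)) :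
  is_submod P -> (forall x y, P (tens x y)) -> forall t, P t.
Proof.
move=> sP Pt t; rewrite -[t]quot_piK; set g := repr t.
rewrite [g]monalgE linear_sum.
case: sP => P0 PD PZ; apply: (big_ind P) => // -[x y] _.
rewrite (_ : mkmalgU (x, y) _ = mcoeff (x, y) g *: pure_sym x y).
  by rewrite linearZ; apply: PZ; exact: Pt.
by apply/malgP => k; rewrite mcoeffZ !mcoeffU; case: eqP => _; rewrite ?mulr1 ?mulr0.
Qed.

Lemma tensor_linear_ext (L : lmodType R) (f g : {linear tensor M N -> L}) :
  (forall x y, f (tens x y) = g (tens x y)) -> f =1 g.
Proof.
move=> fg; apply: tensor_ind fg; split=> [|u v fu fv|a u fu]; rewrite /mkset.
- by rewrite !linear0.
- by rewrite !linearD fu fv.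
- by rewrite !linearZ fu.
Qed.

Lemma tensor_lift (L : lmodType R) (B : M -> N -> L) :
  (forall x x' y, B (x + x') y = B x y + B x' y) ->
  (forall x y y', B x (y + y') = B x y + B x y') ->
  (forall a x y, B (a *: x) y = a *: B x y) ->
  (forall a x y, B x (a *: y) = a *: B x y) ->
  exists f : {linear tensor M N -> L}, forall x y, f (tens x y) = B x y.
Proof.
move=> BDl BDr BZl BZr.
pose f : {linear malg (M * N)%type R -> L} := free_lift (fun z : M * N => B z.1 z.2).
have fE x y : f (pure_sym x y) = B x y.
  rewrite /f /= (@free_liftEw _ _ _ _ [fset (x, y)]%fset) ?msuppU_le //.
  by rewrite big_seq_fset1 mcoeffUU scale1r.
have f0 v : v \in gen_submod (@tensor_rel _ M N) -> f v = 0.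
  move=> /asboolP[n [c [a [ra ->]]]]; rewrite linear_sum big1 // => i _.
  rewrite linearZ /=; suff -> : f (a i) = 0 by rewrite scaler0.
  case: (ra i) => [[[|]|]|] [z _ <-]; rewrite !linearB ?linearZ /= !fE.
  - by rewrite BDl addrAC addrK subrr.
  - by rewrite BDr addrAC addrK subrr.
  - by rewrite BZl scalerN subrr.
  - by rewrite BZr scalerN subrr.
by exists (quot_lift f0) => x y; exact: etrans (quot_liftE _ _) (fE _ _).
Qed.

End TensorProduct.

Section Lifting.
Variables (R : comNzRingType).

Lemma rV_lift n (W X : lmodType R) (h : {linear 'rV[R]_n -> W}) (f : {linear X -> W}) :
  (forall u, exists x, f x = h u) -> exists h' : {linear 'rV[R]_n -> X}, forall u, f (h' u) = h u.
Proof.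
move=> ex; have [g gP] := choice (fun i => ex (delta_mx 0 i)).
exists (row_comb g) => u; rewrite [RHS]linear_rowE linear_sum.
by apply: eq_bigr => i _; rewrite linearZ /= gP.
Qed.

Lemma free_coverU (V : lmodType R) (v : V) : free_cover V (mkmalgU v 1) = v.
Proof.
rewrite /free_cover /= (@free_liftEw _ _ _ _ [fset v]%fset) ?msuppU_le //.
by rewrite big_seq_fset1 mcoeffUU scale1r.
Qed.

Lemma malg_lift (K : choiceType) (W X : lmodType R) (h : {linear malg K R -> W})
    (f : {linear X -> W}) : (forall u, exists x, f x = h u) ->
  exists h' : {linear malg K R -> X}, forall u, f (h' u) = h u.
Proof.
move=> ex; have [g gP] := choice (fun k => ex (mkmalgU k 1)).
exists (free_lift g) => u; rewrite /= /free_lift linear_sum [in RHS](monalgE u) linear_sum.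
apply: eq_bigr => k _; rewrite linearZ /= gP -linearZ; congr (h _).
by apply/malgP => k'; rewrite mcoeffZ !mcoeffU; case: eqP => _; rewrite ?mulr1 ?mulr0.
Qed.

Lemma ker_val (X Y : lmodType R) (f : {linear X -> Y}) (z : submod_type (lin_ker f)) :
  f (val z) = 0.
Proof. by apply/eqP; exact: (valP z). Qed.

Lemma ker_factor (A X Y : lmodType R) (f : {linear X -> Y}) (g : {linear A -> X}) :
  (forall a, f (g a) = 0) ->
  exists h : {linear A -> submod_type (lin_ker f)}, forall a, val (h a) = g a.
Proof.
move=> fg0; have kg a : g a \in lin_ker f by rewrite unfold_in fg0.
pose h a : submod_type (lin_ker f) := exist _ (g a) (kg a).
have hl : linear h by move=> c x y; apply: val_inj; rewrite linearP /= linearP.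
pose H : {linear A -> submod_type (lin_ker f)} := HB.pack h (GRing.isLinear.Build R A _ *:%R h hl).
by exists H.
Qed.

(* [W] is a direct summand of [V] up to maps factoring through finite free modules. *)
Definition stable_retract (W V : lmodType R) : Prop :=
  exists (a : {linear W -> V}) (b : {linear V -> W}) k
    (r : {linear W -> 'rV[R]_k}) (s : {linear 'rV[R]_k -> W}),
  forall w, b (a w) = w + s (r w).

Lemma stable_retract_refl (W : lmodType R) : stable_retract W W.
Proof.
exists idfun, idfun, 0%N, \0, \0 => w /=; by rewrite addr0.
Qed.

(** As in Schanuel's lemma, [a] and [b] lift to the free covers and restrict to the kernels. The
    composite of the lifts differs from the identity by [s0 \o r \o f], which vanishes on the kernel
    of [f], and by a map of a finite free module into that kernel. *)
Lemma syzygy_stable_retract (W V : lmodType R) n (f : {linear 'rV[R]_n -> W}) :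
  (forall w, exists u, f u = w) -> stable_retract W V ->
  stable_retract (submod_type (lin_ker f)) (submod_type (lin_ker (free_cover V))).
Proof.
move=> fs [a [b [k [r [s bas]]]]]; set c := free_cover V.
have cs v : exists t, c t = v by exists (mkmalgU v 1); exact: free_coverU.
have [a0 a0P] := rV_lift (h := a \o f) (fun u => cs _).
have [b0 b0P] := malg_lift (h := b \o c) (fun u => fs _).
have [s0 s0P] := rV_lift (h := s) (fun u => fs _).
pose vf : {linear submod_type (lin_ker f) -> 'rV[R]_n} := val.
pose vc : {linear submod_type (lin_ker c) -> malg V R} := val.
have vf0 z : f (vf z) = 0 by apply/eqP; exact: (valP z).
have vc0 z : c (vc z) = 0 by apply/eqP; exact: (valP z).
have [|a' a'P] := @ker_factor _ _ _ c (a0 \o vf).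
  by move=> z; rewrite a0P /= vf0 linear0.
have [|b' b'P] := @ker_factor _ _ _ f (b0 \o vc).
  by move=> z; rewrite b0P /= vc0 linear0.
have [|t tP] := @ker_factor _ _ _ f ((b0 \o a0) \- idfun \- (s0 \o r \o f)).
  by move=> u; rewrite /= !linearB /= b0P s0P /= a0P /= bas addrAC addrK subrr.
exists a', b', n, vf, t => z; apply: val_inj.
apply: etrans (b'P _) _; rewrite /= [X in b0 X](a'P z) /=.
have /= -> := tP (vf z); have /= -> := vf0 z.
by rewrite !linear0 addr0 addrC subrK.
Qed.

End Lifting.

Section Comparison.
Variables (R : comNzRingType) (W V : lmodType R) (b0 b1 b2 : nat).
Variables (pi : {linear 'rV[R]_b0 -> W}) (A1 : 'M[R]_(b1, b0)) (A2 : 'M[R]_(b2, b1)).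
Variables (K0 K1 K2 : choiceType).
Local Notation F0 := (malg K0 R).
Local Notation F1 := (malg K1 R).
Local Notation F2 := (malg K2 R).
Variables (c : {linear F0 -> V}) (d1 : {linear F1 -> F0}) (d2 : {linear F2 -> F1}).
Hypothesis WV : stable_retract W V.
Hypothesis pi_surj : forall w, exists u, pi u = w.
Hypothesis ex0 : forall u, pi u = 0 <-> exists v, v *m A1 = u.
Hypothesis ex1 : forall u : 'rV[R]_b1, u *m A1 = 0 <-> exists v, v *m A2 = u.

Hypothesis c_surj : forall v, exists t, c t = v.
Hypothesis exc : forall t, c t = 0 <-> exists x, d1 x = t.
Hypothesis d1d2 : forall t, d1 (d2 t) = 0.

(** Chain maps in both directions lift [a] and [b], and [h0], [h1] form a homotopy. The defect
    [s \o r] enters only through [s0 \o r \o pi], which vanishes on the image of [A1], so it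
    disappears in degree one. *)
Lemma comparison :
  exists (beta0 : {linear 'rV[R]_b0 -> F0}) (beta1 : {linear 'rV[R]_b1 -> F1})
    (alpha1 : {linear F1 -> 'rV[R]_b1}) (alpha2 : {linear F2 -> 'rV[R]_b2})
    (h0 : {linear 'rV[R]_b0 -> 'rV[R]_b1}) (h1 : {linear 'rV[R]_b1 -> 'rV[R]_b2}),
  [/\ forall u, d1 (beta1 u) = beta0 (u *m A1),
      forall t, alpha1 (d2 t) = alpha2 t *m A2
    & forall u, alpha1 (beta1 u) = u + h1 u *m A2 + h0 (u *m A1)].
Proof.
have [a [b [k [r [s bas]]]]] := WV.
have cd1 t : c (d1 t) = 0 by apply/exc; exists t.
have piA1 u : pi (u *m A1) = 0 by apply/ex0; exists u.
have [be0 be0P] := rV_lift (h := a \o pi) (fun u => c_surj _).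
have [|be1 be1P] := @rV_lift _ _ _ _ (be0 \o mulmxr A1) (d1).
  by move=> u; apply/exc; rewrite [LHS]be0P /= piA1 linear0.
have [al0 al0P] := malg_lift (h := b \o c) (fun u => pi_surj _).
have [|al1 al1P] := @malg_lift _ _ _ _ (al0 \o d1) (mulmxr A1).
  by move=> u; apply/ex0; rewrite [LHS]al0P /= cd1 linear0.
have [|al2 al2P] := @malg_lift _ _ _ _ (al1 \o d2) (mulmxr A2).
  move=> u; apply/ex1; transitivity (al0 (d1 (d2 u))).
    exact: al1P.
  by rewrite d1d2 linear0.
have [s0 s0P] := rV_lift (h := s) (fun u => pi_surj _).
have [|h0 h0P] := @rV_lift _ _ _ _ ((al0 \o be0) \- idfun \- (s0 \o r \o pi)) (mulmxr A1).
  move=> u; apply/ex0; rewrite /= !linearB /= al0P s0P /= be0P /= bas.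
  by rewrite addrAC addrK subrr.
have [|h1 h1P] := @rV_lift _ _ _ _ ((al1 \o be1) \- idfun \- (h0 \o mulmxr A1)) (mulmxr A2).
  move=> u; apply/ex1; rewrite /= !mulmxBl.
  have := h0P (u *m A1); rewrite /= => ->; rewrite piA1 !linear0 addr0.
  have := al1P (be1 u); rewrite /= => ->; have /= -> := be1P u.
  by rewrite subrr.
exists be0, be1, al1, al2, h0, h1; split=> [||u].
- exact: be1P.
- by move=> t; rewrite -[LHS]al2P.
- by have /= -> := h1P u; rewrite addrA [u + _]addrC !subrK.
Qed.

Section Frobenius.
Variables (p : nat) (charRp : p \in [pchar R]) (e : nat).
Local Notation Fr := (frob_pow e charRp).
Local Notation N := (frob_twist charRp e (R^o : lmodType R)).

(** The chain, given in the complex of Frobenius powers of [A1] and [A2], is pulled back along the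
    map induced by [alpha1]. It stays strict because, by the homotopy, the round trip of a cycle is
    the cycle itself modulo boundaries. *)
Lemma homology_length_ge (RR : realType) (C : nat -> set 'rV[R]_b1) n :
  (forall i, (i <= n)%N ->
     [/\ is_submod (C i : set (frob_twist charRp e 'rV[R]_b1)),
         forall v, C i (v *m map_mx Fr A2) & forall v, C i v -> v *m map_mx Fr A1 = 0]) ->
  (forall i, (i < n)%N -> C i `<=` C i.+1 /\ exists v, C i.+1 v /\ ~ C i v) ->
  (n%:R%:E <= mod_length RR (homology (tensor_map N d2) (tensor_map N d1)))%E.
Proof.
move=> cP cc; have [be0 [be1 [al1 [al2 [h0 [h1 [be1P al2P albe]]]]]]] := comparison.
(* Tensoring a free module with the twisted ring raises coordinates to the [q]-th power and then
   multiplies by [y]. *)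
have twist_lift k (M : lmodType R) (al : {linear M -> 'rV[R]_k}) :
    exists f : {linear tensor M N -> frob_twist charRp e 'rV[R]_k},
    forall x (y : R), f (tens x (y : N)) = y *: map_mx Fr (al x).
  apply: (tensor_lift (B := fun x (y : N) => (y : R) *: map_mx Fr (al x) :
     frob_twist charRp e 'rV[R]_k)).
  - by move=> x x' y; rewrite linearD map_mxD scalerDr.
  - by move=> x y y'; rewrite scalerDl.
  - move=> a x y; rewrite linearZ map_mxZ.
    by rewrite -[RHS]/(Fr a *: (_ *: _)) !scalerA mulrC.
  - by move=> a x y; rewrite -[RHS]/(Fr a *: (_ *: _)) scalerA.
have [f1 f1P] := twist_lift _ _ al1.
have [f2 f2P] := twist_lift _ _ al2.
pose be (z : 'rV[R]_b1) : tensor (F1) N :=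
  \sum_j tens (be1 (delta_mx 0 j)) (z 0 j : N).
have beker z : z *m map_mx Fr A1 = 0 -> tensor_map N d1 (be z) = 0.
  move=> zA; rewrite linear_sum.
  (* An entry of [A1] crosses the tensor sign as its [q]-th power, so the sum collects the
     coordinates of [z *m map_mx Fr A1]. *)
  under eq_bigr => j _.
    rewrite tensor_mapE be1P -rowE linear_rowE tens_suml.
    under eq_bigr => k _ do rewrite mxE tensZl -tensZr.
    over.
  rewrite exchange_big big1 //= => k _; rewrite -tens_sumr.
  have zAk : \sum_(j < b1) (Fr (A1 j k) * z 0 j : R) = 0.
    have /rowP/(_ k) := zA; rewrite !mxE => zk; rewrite -[RHS]zk; apply: eq_bigr => j _.
    by rewrite mxE mulrC.
  by rewrite [X in tens _ X]zAk -(scale0r (0 : N)) tensZr scale0r.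
have Hl : linear (fun v : frob_twist charRp e 'rV[R]_b2 =>
    (v : 'rV[R]_b2) *m map_mx Fr A2 : frob_twist charRp e 'rV[R]_b1).
  by move=> a u v; rewrite mulmxDl; congr (_ + _); rewrite -scalemxAl.
pose H : {linear frob_twist charRp e 'rV[R]_b2 -> frob_twist charRp e 'rV[R]_b1} :=
  HB.pack (fun v : frob_twist charRp e 'rV[R]_b2 =>
    (v : 'rV[R]_b2) *m map_mx Fr A2 : frob_twist charRp e 'rV[R]_b1)
    (GRing.isLinear.Build R _ _ *:%R _ Hl).
have f1d t : f1 (tensor_map N d2 t) = f2 t *m map_mx Fr A2.
  move: t; apply: (tensor_linear_ext (f := f1 \o tensor_map N d2) (g := H \o f2)) => x y.
  transitivity (f1 (tensor_map N d2 (tens x y))) => //.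
  transitivity ((f2 (tens x y) : 'rV[R]_b2) *m map_mx Fr A2) => //.
  by rewrite tensor_mapE f1P f2P al2P map_mxM scalemxAl.
have fbe z : f1 (be z) = z *m map_mx Fr (lin1_mx (al1 \o be1)).
  rewrite linear_sum; apply/rowP => k; rewrite mxE summxE.
  by apply: eq_bigr => j _; rewrite f1P !mxE.
pose d i : set (tensor (F1) N) := [set t | tensor_map N d1 t = 0 /\ C i (f1 t)].
apply: (@mod_length_homology_ge _ _ _ _ _ _ _ d) => [i le_in|i lt_in].
  have [[c0 cD cZ] cA _] := cP i le_in; split=> [|t|t []] //.
    exact: (is_submod_ker_preim (tensor_map N d1) f1 (And3 c0 cD cZ)).
  split; last by rewrite f1d; exact: cA.
  move: t; apply: (tensor_linear_ext (f := tensor_map N d1 \o tensor_map N d2) (g := \0)).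
  move=> x y; transitivity (tensor_map N d1 (tensor_map N d2 (tens x y))) => //.
  by rewrite !tensor_mapE d1d2 -(scale0r (0 : F0)) tensZl scale0r.
have [le_c [v [cv ncv]]] := cc i lt_in.
split=> [t [t0 ct]|]; first by split=> //; exact: le_c.
have [[_ cD' _] cA' cker'] := cP i.+1 lt_in.
have [[c0 cD cZ] cA cker] := cP i (ltnW lt_in).
have vA := cker' v cv.
(* The homotopy identity after Frobenius; the term through [h0] vanishes because [v] is a cycle. *)
have fv : f1 (be v) = v + (v *m map_mx Fr (lin1_mx h1)) *m map_mx Fr A2.
  rewrite fbe -[RHS]addr0 -(mul0mx _ (map_mx Fr (lin1_mx h0))) -vA -!mulmxA -!map_mxM.
  rewrite -[X in X + _ + _]mulmx1 -(map_mx1 Fr) -!mulmxDr -!map_mxD; congr (_ *m map_mx Fr _).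
  apply/row_matrixP => j; rewrite rowE mul_rV_lin1 /= albe.
  by rewrite !rowE !mulmxDr mulmx1 !mulmxA !mul_rV_lin1.
exists (be v); split.
  by split; [exact: beker | rewrite fv; exact: cD'].
move=> [_]; rewrite fv => cfv; apply: ncv.
rewrite -[v](addrK ((v *m map_mx Fr (lin1_mx h1)) *m map_mx Fr A2)).
by apply: cD => //; rewrite -mulNmx; exact: cA.
Qed.

End Frobenius.
End Comparison.

Lemma free_cover_exact (R : comNzRingType) (V : lmodType R) (t : malg V R) :
  free_cover V t = 0 <->
  exists x : malg (submod_type (lin_ker (free_cover V))) R, val (free_cover _ x) = t.
Proof.
split=> [ct|[x <-]]; last exact: ker_val.
have kt : t \in lin_ker (free_cover V) by rewrite unfold_in ct.
pose z : submod_type (lin_ker (free_cover V)) := exist _ t kt.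
by exists (mkmalgU z 1); rewrite free_coverU.
Qed.

Lemma free_cover_ker (R : comNzRingType) (V X : lmodType R) (vX : {linear X -> V})
  (z : submod_type (lin_ker (free_cover X))) : vX (free_cover _ (val z)) = 0.
Proof. by rewrite ker_val linear0. Qed.

Lemma free_res_exact (R : comNzRingType) (M : lmodType R) i t :
  free_cover (syzygy M i) t = 0 <-> exists x, free_res_diff M i x = t.
Proof. exact: free_cover_exact. Qed.
Lemma Tor_succE (R : comNzRingType) (M N : lmodType R) i : Tor M N i.+1 =
  homology (tensor_map N (free_res_diff M i.+1)) (tensor_map N (free_res_diff M i)).
Proof. by []. Qed.
Lemma free_res_diff_diff (R : comNzRingType) (M : lmodType R) i t :
  free_res_diff M i (free_res_diff M i.+1 t) = 0.
Proof.
pose vK : {linear syzygy M i.+1 -> free_res M i} :=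
  (val : submod_type (lin_ker (free_cover (syzygy M i))) -> _).
exact: (free_cover_ker vK). Qed.

(** From degree [h] on, the canonical resolution of [M] resolves its [h]-th syzygy, to which [W] is
    compared. *)
Lemma tor_chain_length (R : comNzRingType) (M W : lmodType R) h b0 b1 b2
    (pi : {linear 'rV[R]_b0 -> W}) (A1 : 'M[R]_(b1, b0)) (A2 : 'M[R]_(b2, b1)) :
  stable_retract W (syzygy M h) -> (forall w, exists u, pi u = w) ->
  (forall u, pi u = 0 <-> exists v, v *m A1 = u) ->
  (forall u : 'rV[R]_b1, u *m A1 = 0 <-> exists v, v *m A2 = u) ->
  forall p (charRp : p \in [pchar R]) e (RR : realType) (C : nat -> set 'rV[R]_b1) n,
  (forall i, (i <= n)%N ->
     [/\ is_submod (C i : set (frob_twist charRp e 'rV[R]_b1)),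
         forall v, C i (v *m map_mx (frob_pow e charRp) A2)
       & forall v, C i v -> v *m map_mx (frob_pow e charRp) A1 = 0]) ->
  (forall i, (i < n)%N -> C i `<=` C i.+1 /\ exists v, C i.+1 v /\ ~ C i v) ->
  (n%:R%:E <= mod_length RR (Tor M (frob_twist charRp e (R^o : lmodType R)) h.+1))%E.
Proof.
move=> WV pis ex0 ex1 p charRp e RR C n CP CC.
rewrite Tor_succE.
apply: (@homology_length_ge R W (syzygy M h) b0 b1 b2 pi A1 A2 (syzygy M h) (syzygy M h.+1)
   (syzygy M h.+2) (free_cover _) _ _ WV pis ex0 ex1 _ _ _ p charRp e RR C n CP CC).
- by move=> v; exists (mkmalgU v 1); exact: free_coverU.
- exact: free_res_exact.
- exact: free_res_diff_diff.
Qed.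

(** * Length of Tor *)

Lemma good_ann (R : comNzRingType) (m : idealr R) (y : R) j z :
  good m y -> y ^+ j * z = 0 -> y * z = 0.
Proof.
move=> [_ _ yy _]; elim: j z => [|j IH] z; first by rewrite mul1r => ->; rewrite mulr0.
by rewrite exprSr -mulrA => /IH/yy.
Qed.

Lemma good_annZ (R : comNzRingType) (m : idealr R) (y : R) j n (z : 'rV[R]_n) :
  good m y -> y ^+ j *: z = 0 -> y *: z = 0.
Proof.
move=> gy /rowP yz; apply/rowP => k; have := yz k; rewrite !mxE.
exact: good_ann gy.
Qed.

Section Layers.
Variables (R : comNzRingType) (m : idealr R).
Hypotheses (noethR : noetherian R) (localR : local_ring m).
Variables (p : nat) (charRp : p \in [pchar R]) (e : nat).
Variables (I : finType) (u : I -> R) (V : lmodType R) (n : nat) (g : 'I_n -> V).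
Variables (i0 : 'I_n) (y : R).
Local Notation F := (frob_pow e charRp).
Local Notation w := (g i0).

(* As [j] decreases from [J] and [s] increases, the layers form a chain of subgroups between
   [y ^+ J.+1 *: Z] and [Z], where [Z = span g].
   They are submodules only for the Frobenius twist, and the [#|I|] steps for each [j] account
   for the factor [q ^ alpha] in the normalization. *)
Definition layer j s : set V := [set v | exists z (c : I -> R),
  [/\ span_m m g z, forall i, (s <= enum_rank i)%N -> c i = 0
    & v = y ^+ j *: (z + (\sum_i F (c i) * u i) *: w)]].

Lemma is_submod_layer j s : is_submod (layer j s : set (frob_twist charRp e V)).
Proof.
have [z0 zD zZ] := is_submod_span_m m g.
split=> [|_ _ [z [c [gz c0 ->]]] [z' [d [gz' d0 ->]]]|a _ [z [c [gz c0 ->]]]].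
- exists 0, (fun=> 0); split=> //; rewrite big1 ?scale0r ?addr0 ?scaler0 // => i _.
  by rewrite rmorph0 mul0r.
- exists (z + z'), (fun i => c i + d i); split=> [|i si|]; first exact: zD.
    by rewrite c0 ?d0 ?addr0.
  apply: etrans (esym (scalerDr (y ^+ j) _ _)) _.
  rewrite addrACA -scalerDl -big_split /=.
  by congr (_ *: (_ + _ *: _)); apply: eq_bigr => i _; rewrite rmorphD mulrDl.
- exists (F a *: z), (fun i => a * c i); split=> [|i si|]; first exact: zZ.
    by rewrite c0 ?mulr0.
  rewrite -[LHS]/(F a *: (_ *: _)) scalerA mulrC -scalerA; congr (_ *: _).
  rewrite scalerDr scalerA mulr_sumr; congr (_ + _ *: _); apply: eq_bigr => i _.
  by rewrite rmorphM mulrA.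
Qed.

Lemma layer_span j s : layer j s `<=` [set v | exists z, span g z /\ v = y ^+ j *: z].
Proof.
move=> _ [z [c [gz _ ->]]]; eexists; split; last by [].
have [_ sD sZ] := is_submod_span g.
by apply: sD; [exact: span_m_sub gz | apply: sZ; exact: span_gen].
Qed.

(** As [j < k], a factor [y] can be spared to bring [y ^+ (k - j) *: z] into [span_m m g]. *)
Lemma layer_ge j s k z : y \in m -> span g z -> (j < k)%N -> layer j s (y ^+ k *: z).
Proof.
move=> ym gz lt_jk; exists (y *: (y ^+ (k - j.+1) *: z)), (fun=> 0); split=> //.
  apply: span_mZ => //; have [_ _ sZ] := is_submod_span g; exact: sZ.
rewrite big1 ?scale0r ?addr0 => [|i _]; last by rewrite rmorph0 mul0r.
by rewrite !scalerA -exprSr -exprD subnKC.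
Qed.

Lemma layer_next j s : y \in m -> layer j.+1 s `<=` layer j 0.
Proof. by move=> ym v /layer_span[z [gz ->]]; exact: layer_ge. Qed.

Hypothesis indep : frob_indep m charRp e u.

(** The new vector is [y ^+ j *: (u k *: w)] with [k] of rank [s]. If it lay in the smaller layer, a
    unit multiple of [y ^+ j *: w] would lie in [y ^+ j] times [span_m m g]. *)
Lemma layer_S j s : (s < #|I|)%N ->
  (forall z, span_m m g z -> y ^+ j *: w <> y ^+ j *: z) ->
  layer j s `<=` layer j s.+1 /\ exists v, layer j s.+1 v /\ ~ layer j s v.
Proof.
move=> lt_s nw; split=> [v [z [c [gz c0 ->]]]|].
  by exists z, c; split=> // i /ltnW; exact: c0.
have [z0 _ zZ] := is_submod_span_m m g.
pose k : I := enum_val (Ordinal lt_s).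
have rk : enum_rank k = Ordinal lt_s by rewrite enum_valK.
exists (y ^+ j *: (u k *: w)); split.
  exists 0, (fun i => (i == k)%:R); split=> // [i|]; last first.
    rewrite add0r (bigD1 k) //= eqxx rmorph1 mul1r big1 ?addr0 // => i /negPf->.
    by rewrite rmorph0 mul0r.
  by case: eqP => [->|//]; rewrite rk /= ltnn.
move=> [z [c [gz c0 E]]].
(* Since [c k = 0], the coefficient [d k] is [1], and independence makes the combination a unit. *)
pose d i := (i == k)%:R - c i.
have dE : \sum_i F (d i) * u i = u k - \sum_i F (c i) * u i.
  under eq_bigr => i _ do rewrite rmorphB mulrBl.
  rewrite sumrB; congr (_ - _); rewrite (bigD1 k) //= eqxx rmorph1 mul1r.
  by rewrite big1 ?addr0 // => i /negPf->; rewrite rmorph0 mul0r.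
have dm : \sum_i F (d i) * u i \notin m.
  apply/negP => /indep/(_ k); rewrite /d eqxx c0 ?rk // subr0.
  by rewrite idealr1.
have [t td] := local_unit noethR localR dm.
apply: (nw (t *: z)); first exact: zZ.
rewrite -[w]scale1r -td dE -scalerA !(scalerA (y ^+ j)) ![y ^+ j * t]mulrC -!scalerA.
congr (_ *: _); rewrite scalerBl scalerBr E scalerDr.
by rewrite addrK.
Qed.

Lemma layer_chain J : y \in m -> (0 < #|I|)%N ->
  (forall z, span_m m g z -> y ^+ J *: w <> y ^+ J *: z) ->
  exists C : nat -> set V,
    (forall i, exists j s, (j <= J)%N /\ C i = layer j s) /\
    forall i, (i < J * #|I|)%N -> C i `<=` C i.+1 /\ exists v, C i.+1 v /\ ~ C i v.
Proof.
move=> ym I0 nJ; set N := #|I| in I0 *.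
(* Multiplying by [y ^+ (J - j)] turns a failure at [j] into one at [J]. *)
have nw j : (j <= J)%N -> forall z, span_m m g z -> y ^+ j *: w <> y ^+ j *: z.
  move=> le_jJ z gz E; apply: (nJ z gz).
  by rewrite -(subnK le_jJ) exprD -!scalerA E.
exists (fun i => layer (J - i %/ N) (i %% N)); split=> [i|i lt_i].
  by exists (J - i %/ N)%N, (i %% N)%N; rewrite leq_subr.
have lt_a : (i %/ N < J)%N by rewrite ltn_divLR.
have lt_s : (i %% N < N)%N by rewrite ltn_mod.
have [le_L [v [Lv nLv]]] := layer_S lt_s (nw _ (leq_subr (i %/ N) J)).
have [lt_s'|] := ltnP (i %% N).+1 N.
  have -> : (i.+1 %/ N)%N = (i %/ N)%N.
    by rewrite {1}(divn_eq i N) -addnS divnMDl // (divn_small lt_s') addn0.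
  have -> : (i.+1 %% N)%N = (i %% N).+1.
    by rewrite {1}(divn_eq i N) -addnS modnMDl modn_small.
  by split=> //; exists v.
(* End of a block: the remainder returns to [0], and the full layer is contained in the first one of
   the next lower power of [y]. *)
move=> le_N; have eN : (i %% N).+1 = N by apply/eqP; rewrite eqn_leq lt_s.
have ei : i.+1 = ((i %/ N).+1 * N)%N.
  by rewrite {1}(divn_eq i N) -addnS eN mulSn addnC.
rewrite ei mulnK // modnMl.
have nx : layer (J - i %/ N) (i %% N).+1 `<=` layer (J - (i %/ N).+1) 0.
  by rewrite -subSS subSn //; exact: layer_next.
split; first exact: subset_trans nx.
by exists v; split=> //; exact: nx.
Qed.

End Layers.

(** * Minimal presentations and vanishing of Tor *)

Section MinimalPresentation.
Variables (R : comNzRingType) (m : idealr R).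
Hypotheses (noethR : noetherian R) (localR : local_ring m).

(** Finite generation is bundled so that the passage to syzygies can be iterated. *)
Definition fg_mod := {W : lmodType R | fg W}.

Lemma fg_ker n (X : lmodType R) (f : {linear 'rV[R]_n -> X}) : fg (submod_type (lin_ker f)).
Proof.
have [k [g [kg sg]]] := noeth_fg_rV noethR (is_submod_mem (lin_ker f : submodClosed _)).
exists k, (fun i => exist _ (g i) (kg i)); split=> // z _.
have [c ec] := sg _ (valP z); exists c; apply: val_inj.
by rewrite [LHS]ec raddf_sum; apply: eq_bigr.
Qed.

Definition fg_kernel n (X : lmodType R) (f : {linear 'rV[R]_n -> X}) : fg_mod :=
  exist (fun W : lmodType R => fg W) (submod_type (lin_ker f)) (fg_ker f).

Definition min_rank (W : fg_mod) : nat :=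
  sval (cid (fg_min_cover noethR localR (svalP W))).

Definition min_cover (W : fg_mod) : {linear 'rV[R]_(min_rank W) -> sval W} :=
  sval (cid (svalP (cid (fg_min_cover noethR localR (svalP W))))).

Lemma min_cover_surj W w : exists u, min_cover W u = w.
Proof.
exact: (svalP (cid (svalP (cid (fg_min_cover noethR localR (svalP W)))))).1.
Qed.

Lemma min_cover_ker W u : min_cover W u = 0 -> forall j, u 0 j \in m.
Proof.
exact: (svalP (cid (svalP (cid (fg_min_cover noethR localR (svalP W)))))).2.
Qed.

Section Presentation.
Variables (n : nat) (X : lmodType R) (f : {linear 'rV[R]_n -> X}).

Definition pres_map : {linear 'rV[R]_(min_rank (fg_kernel f)) -> 'rV[R]_n} :=
  (val : submod_type (lin_ker f) -> 'rV[R]_n) \o min_cover (fg_kernel f).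

(** Matrices act on row vectors from the right, so the rows are generators of the kernel of [f]. *)
Definition pres_mx : 'M[R]_(min_rank (fg_kernel f), n) := lin1_mx pres_map.

Lemma mul_pres_mx u : u *m pres_mx = pres_map u.
Proof. exact: mul_rV_lin1. Qed.

Lemma pres_map0 u : f (pres_map u) = 0.
Proof. exact: (ker_val (f := f)). Qed.

Lemma pres_mxP u : f u = 0 <-> exists v, v *m pres_mx = u.
Proof.
split=> [fu|[v <-]]; last by rewrite mul_pres_mx pres_map0.
have ku : u \in lin_ker f by rewrite unfold_in fu.
have [v ev] := min_cover_surj (exist _ u ku : sval (fg_kernel f)).
by exists v; rewrite mul_pres_mx /pres_map /= ev.
Qed.

Lemma pres_mx_eq0 u : u *m pres_mx = 0 <-> min_cover (fg_kernel f) u = 0.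
Proof.
rewrite mul_pres_mx; split=> [u0|u0]; first exact: val_inj.
by rewrite /pres_map /= u0.
Qed.

End Presentation.

(** Each row is a relation among the generators of a minimal cover. *)
Lemma pres_mx_min (W : fg_mod) i j : pres_mx (min_cover W) i j \in m.
Proof.
have /min_cover_ker/(_ j) := pres_map0 (f := min_cover W) (delta_mx 0 i).
by rewrite /pres_mx mxE.
Qed.

Section Vanishing.
Variables (RR : realType) (p : nat) (charRp : p \in [pchar R]).
Variables (M W : lmodType R) (h n : nat) (f : {linear 'rV[R]_n -> W}) (y : R).
Hypotheses (fsurj : forall w, exists u, f u = w) (WV : stable_retract W (syzygy M h)).
Hypothesis gy : good m y.
Let A1 := pres_mx f.
Let A2 := pres_mx (min_cover (fg_kernel f)).

Lemma pres_mx_comp e : map_mx (frob_pow e charRp) A2 *m map_mx (frob_pow e charRp) A1 = 0.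
Proof.
rewrite -map_mxM (_ : A2 *m A1 = 0) ?map_mx0 //.
apply/row_matrixP => i; rewrite rowE mulmxA row0; apply/pres_mx_eq0/pres_mxP.
by exists (delta_mx 0 i).
Qed.

(** The layers of the cycle module [Z] lie between boundaries and cycles. Of the factor [y ^+ J.+2],
    one [y] moves the values of [B] into [Z], and [y ^+ J.+1] puts the boundaries inside all layers
    with [j <= J]. *)
Lemma tor_length_ge e J (I : finType) (u : I -> R) (B : 'M[R]_(_, _)) :
  (0 < #|I|)%N -> frob_indep m charRp e u ->
  map_mx (frob_pow e charRp) A2 = y ^+ J.+2 *: B ->
  (exists z : 'rV_(min_rank (fg_kernel f)),
     z *m map_mx (frob_pow e charRp) A1 = 0 /\ y *: z != 0) ->
  ((J * #|I|)%:R%:E <= mod_length RR (Tor M (frob_twist charRp e (R^o : lmodType R)) h.+1))%E.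
Proof.
move=> I0 iu AB [z [zA yz]]; have [ym _ _ _] := gy.
pose FA := map_mx (frob_pow e charRp) A1.
pose Z := [set v : 'rV[R]_(min_rank (fg_kernel f)) | v *m FA = 0].
have sZ : is_submod Z.
  split=> [|v v' Zv Zv'|a v Zv]; rewrite /Z /=; first exact: mul0mx.
    by rewrite mulmxDl Zv Zv' addr0.
  by rewrite -scalemxAl Zv scaler0.
have [k [g [Zg sg]]] := noeth_fg_rV noethR sZ.
have gZ : span g `<=` Z by exact: span_min.
(* If [y ^+ J] killed all generators of [Z], then [y] would kill [z], as [y] is [good]. *)
have [|i0 i0P] := nakayama_scale noethR localR (g := g) (a := y ^+ J).
  apply: contrapT => nex; move/negP: yz; apply; apply/eqP.
  apply: (good_annZ (j := J) gy).
  have [c ->] := sg _ zA; rewrite scaler_sumr big1 // => i _.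
  rewrite scalerA mulrC -scalerA; suff -> : y ^+ J *: g i = 0 by rewrite scaler0.
  by apply/eqP; apply: contrapT => /negP gi; apply: nex; exists i.
have [C [CP CC]] := layer_chain noethR localR iu ym I0 i0P.
have ex1 (v : 'rV_(min_rank (fg_kernel f))) : v *m A1 = 0 <-> exists v', v' *m A2 = v.
  exact: iff_trans (pres_mx_eq0 v) (pres_mxP _ v).
apply: (@tor_chain_length R M W h _ _ _ f A1 A2 WV fsurj (pres_mxP f) ex1 p charRp e RR C)
  => [i _|//].
have [j [s [le_jJ ->]]] := CP i; split=> [|v|v].
- exact: is_submod_layer.
- rewrite AB -scalemxAr exprSr -scalerA.
  apply: layer_ge => //; apply: sg; rewrite /Z /= -scalemxAl.
  apply: (good_annZ (j := J.+2) gy).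
  by rewrite scalemxAl scalemxAr -AB -mulmxA pres_mx_comp mulmx0.
- move=> /layer_span[v' [/gZ Zv' ->]].
  by rewrite -scalemxAl [X in _ *: X]Zv' scaler0.
Qed.

Lemma frob_pow_dvd e n0 : (0 < n0)%N ->
  (forall i j, exists r, A2 i j ^+ n0 = r * y) ->
  exists B, map_mx (frob_pow e charRp) A2 = y ^+ (p ^ e %/ n0) *: B.
Proof.
move=> n0_gt0 A2n0.
have ex (ij : 'I_(_) * 'I_(_)) : exists r, A2 ij.1 ij.2 ^+ n0 = r * y by exact: A2n0.
have [r rP] := choice ex.
exists (\matrix_(i, j) (r (i, j) ^+ (p ^ e %/ n0) * A2 i j ^+ (p ^ e %% n0))).
apply/matrixP => i j; rewrite [LHS]mxE [RHS]mxE [X in _ = _ * X]mxE.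
rewrite /frob_pow {1}(divn_eq (p ^ e) n0).
have /= rij := rP (i, j).
by rewrite exprD [(_ %/ _ * _)%N]mulnC exprM rij exprMn mulrA [_ * y ^+ _]mulrC.
Qed.

Lemma tor_vanishing :
  ((fun e => mod_length RR (Tor M (frob_twist charRp e (R^o : lmodType R)) h.+1)
     * (((p ^ e)%:R `^ (1 + alpha RR p m))^-1)%:E)%E @ \oo --> 0%E) ->
  exists e0, forall e, (e0 <= e)%N -> (forall z : 'rV_(min_rank (fg_kernel f)),
      z *m map_mx (frob_pow e charRp) A1 = 0 -> y *: z = 0) /\
    map_mx (frob_pow e charRp) A2 = 0.
Proof.
move=> lim0; have [_ ypow _ _] := gy.
have [n0 [n0_gt0 A2n0]] : exists n0, (0 < n0)%N /\
    forall i j, exists r, A2 i j ^+ n0 = r * y.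
  have ex (ij : 'I_(_) * 'I_(_)) : exists k r, A2 ij.1 ij.2 ^+ k = r * y.
    by apply: ypow; exact: pres_mx_min.
  (* One exponent serves all entries; the successor makes it positive. *)
  have [k kP] := choice ex; exists (\max_ij k ij).+1; split=> // i j.
  have [r rP] := kP (i, j); exists (A2 i j ^+ ((\max_ij k ij).+1 - k (i, j)) * r).
  rewrite -mulrA -rP /= -exprD subnK //.
  by apply: leqW; exact: (leq_bigmax (i, j)).
have p1 : (1 < p)%N by rewrite prime_gt1 // (pcharf_prime charRp).
(* For [q >= 4 * n0] and [J = q %/ n0 - 2] one has [J >= 2], so [q < (J + 3) * n0 <= 4 * n0 * J] and
   the lower bound [J / q] is at least [eps]. *)
pose eps : RR := (4 * n0)%:R^-1.
have eps0 : 0 < eps by rewrite invr_gt0 ltr0n muln_gt0.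
have /lim0[e1 _ e1P] : nbhs (0%E : \bar RR) [set x | (x < eps%:E)%E].
  by apply: open_nbhs_nbhs; split; [exact: open_ereal_lt_ereal | rewrite /= lte_fin].
exists (maxn e1 (4 * n0)) => e; rewrite geq_max => /andP[le1 le2].
have qn0 : (4 * n0 <= p ^ e)%N.
  exact: ltnW (leq_ltn_trans le2 (ltn_expl e p1)).
have k4 : (4 <= p ^ e %/ n0)%N by rewrite leq_divRL.
pose J := (p ^ e %/ n0 - 2)%N.
have kJ : (p ^ e %/ n0 = J.+2)%N by rewrite /J; lia.
have [B AB] := frob_pow_dvd e n0_gt0 A2n0; rewrite kJ in AB.
have zA (z : 'rV_(min_rank (fg_kernel f))) :
    z *m map_mx (frob_pow e charRp) A1 = 0 -> y *: z = 0.
  move=> zA; apply/eqP; apply: contrapT => /negP yz.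
  have [I [u [I0 iu powE]]] := exists_frob_indep_alpha noethR localR charRp RR e.
  have le_len := tor_length_ge I0 iu AB (ex_intro _ z (conj zA yz)).
  have : (_ * (((p ^ e)%:R `^ (1 + alpha RR p m))^-1)%:E < eps%:E)%E :=
    e1P e le1.
  rewrite powE; apply/negP; rewrite -leNgt.
  have q0 : (0 : RR) < (p ^ e)%:R by rewrite ltr0n expn_gt0 (ltnW p1).
  have c0 : (0 : RR) < #|I|%:R by rewrite ltr0n.
  apply: (@le_trans _ _ ((J * #|I|)%:R%:E * (((p ^ e)%:R * #|I|%:R : RR)^-1)%:E)%E).
    rewrite -EFinM lee_fin /eps.
    have -> : (J * #|I|)%:R * ((p ^ e)%:R * #|I|%:R)^-1 = J%:R / (p ^ e)%:R :> RR.
      by rewrite [(J * _)%:R]natrM invfM mulrACA divff ?mulr1 ?gt_eqF.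
    rewrite ler_pdivlMr // mulrC ler_pdivrMr ?ltr0n ?muln_gt0 // -natrM ler_nat.
    have := divn_eq (p ^ e) n0; have := ltn_pmod (p ^ e) n0_gt0; rewrite kJ; nia.
  by apply: lee_wpmul2r => //; rewrite lee_fin invr_ge0 mulr_ge0 // ltW.
(* A row is [y ^+ J.+2 *: x]. The vector [y *: x] is a cycle, so another [y] kills it, and the
   exponent is at least two. *)
split=> //; apply/row_matrixP => i; rewrite row0 rowE AB -scalemxAr exprSr -scalerA.
pose x : 'rV[R]_(min_rank (fg_kernel f)) := delta_mx 0 i *m B; rewrite -/x.
suff yx : y *: (y *: x) = 0 by rewrite exprSr -!scalerA yx !scaler0.
apply: zA; rewrite -scalemxAl; apply: (good_annZ (j := J.+2) gy).
by rewrite scalemxAl /x scalemxAr -AB -mulmxA pres_mx_comp mulmx0.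
Qed.

End Vanishing.
End MinimalPresentation.

(** * Minimal resolutions *)

Lemma projective_rV (R : comNzRingType) n : projective_mod ('rV[R]_n : lmodType R).
Proof. by move=> A B g f gs; apply: rV_lift => u; exact: gs. Qed.

Lemma frob_betti_dim1 (RR : realType) (R : comNzRingType) p (charRp : p \in [pchar R])
    (m : idealr R) (M : lmodType R) i :
  krull_dim RR (R^o : lmodType R) = 1%E -> frob_betti_is RR charRp m i M R^o 0%E ->
  (fun e => mod_length RR (Tor M (frob_twist charRp e (R^o : lmodType R)) i)
     * (((p ^ e)%:R `^ (1 + alpha RR p m))^-1)%:E)%E @ \oo --> 0%E.
Proof. by rewrite /frob_betti_is /frob_betti_seq => ->. Qed.

Section MinimalResolution.
Variables (R : comNzRingType) (m : idealr R).
Hypotheses (noethR : noetherian R) (localR : local_ring m).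

Local Notation rank := (min_rank noethR localR).
Local Notation cover := (min_cover noethR localR).

(** A basis vector would be a relation with coefficient [1], which is not in [m]. *)
Lemma min_rank_eq0 (W : fg_mod R) : (forall w : sval W, w = 0) -> rank W = 0%N.
Proof.
move=> W0; case E: (rank W) => [//|b].
have j : 'I_(rank W) by rewrite E; exact: ord0.
have := min_cover_ker (W0 (cover W (delta_mx 0 j))) j.
by rewrite mxE !eqxx idealr1.
Qed.

Lemma rV_eq0 b (u : 'rV[R]_b) : b = 0%N -> u = 0.
Proof. by move=> b0; apply/rowP => j; have := ltn_ord j; rewrite [X in (_ < X)%N]b0. Qed.

Variable M : fg_mod R.

Definition min_syzygy (i : nat) : fg_mod R := iter i (fun W => fg_kernel noethR (cover W)) M.

Lemma min_syzygy_stable_retract i : stable_retract (sval (min_syzygy i)) (syzygy (sval M) i).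
Proof.
elim: i => [|i IH]; first exact: stable_retract_refl.
exact: (syzygy_stable_retract (min_cover_surj noethR localR (W := min_syzygy i)) IH).
Qed.

(** The minimal resolution ends at [n]: after a rank [0], every later syzygy sits inside a zero
    module. *)
Lemma projdim_lt_pinfty (RR : realType) n :
  rank (min_syzygy n.+1) = 0%N -> (projdim RR (sval M) < +oo)%E.
Proof.
move=> rk0; rewrite /projdim; case: asboolP => [_|_]; first by [].
apply: le_lt_trans (ltry n%:R); apply: ereal_inf_lbound; exists n => //.
pose d i : {linear 'rV[R]_(rank (min_syzygy i.+1)) -> 'rV[R]_(rank (min_syzygy i))} :=
  pres_map noethR localR (cover (min_syzygy i)).
have ex i u : cover (min_syzygy i) u = 0 <-> exists v, d i v = u.
  apply: (iff_trans (pres_mxP noethR localR (cover (min_syzygy i)) u)).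
  by split=> -[v ev]; exists v; rewrite -ev mul_pres_mx.
exists (fun i => 'rV[R]_(rank (min_syzygy i)) : lmodType R), d, (cover M).
split=> [i||u|i u|i lt_ni u]; first exact: projective_rV.
- exact: min_cover_surj.
- exact: (ex 0%N).
- apply: iff_trans (ex i.+1 u); rewrite -mul_pres_mx.
  exact: pres_mx_eq0.
- apply: rV_eq0; elim: i lt_ni {u} => [//|i IH].
  rewrite ltnS leq_eqVlt => /predU1P[<-//|/IH ri].
  apply: min_rank_eq0 => w; apply: val_inj; exact: rV_eq0.
Qed.

End MinimalResolution.

(** * Finite projective dimension and the Cohen-Macaulay property *)

Section Main.
Variables (RR : realType) (R : comNzRingType) (p : nat) (charRp : p \in [pchar R]).
Variable m : idealr R.
Hypotheses (noethR : noetherian R) (localR : local_ring m).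
Hypothesis dimR : krull_dim RR (R^o : lmodType R) = 1%E.

(** The matrix whose Frobenius power vanishes by the first limit is the one whose twisted kernel is
    killed by [y] by the second. *)
Lemma projdim_frob_betti0 (M : lmodType R) i : fg M ->
  frob_betti_is RR charRp m i.+1 M R^o 0%E -> frob_betti_is RR charRp m i.+2 M R^o 0%E ->
  (projdim RR M < +oo)%E.
Proof.
move=> fgM /(frob_betti_dim1 dimR) lim1 /(frob_betti_dim1 dimR) lim2.
have [x [xm rx]] := exists_rad_m noethR localR dimR.
have [N gy] := rad_m_good noethR localR dimR xm rx.
pose M' : fg_mod R := exist (fun W : lmodType R => fg W) M fgM.
have S := min_syzygy_stable_retract noethR localR M'.
have cs j := min_cover_surj noethR localR (W := min_syzygy noethR localR M' j).
have [e1 e1P] := tor_vanishing noethR localR (cs i) (S i) gy lim1.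
have [e2 e2P] := tor_vanishing noethR localR (cs i.+1) (S i.+1) gy lim2.
pose e := maxn e1 e2.
have [_ A0] := e1P e (leq_maxl _ _).
have [yA _] := e2P e (leq_maxr _ _).
apply: (@projdim_lt_pinfty _ _ noethR localR M' RR i.+1).
apply/eqP; rewrite -leqn0 leqNgt; apply/negP => rk0.
have [_ _ _ /eqP] := gy; apply.
(* Any basis vector is in the kernel of the zero matrix, so [y] kills it and [y = 0]. *)
have /rowP/(_ (Ordinal rk0)) := yA (delta_mx 0 (Ordinal rk0)) (etrans (congr1 _ A0) (mulmx0 _ _)).
by rewrite !mxE !eqxx mulr1.
Qed.

Lemma parameter_regular x : parameter RR x ->
  frob_betti_is RR charRp m 2 (ring_quot [set x]) R^o 0%E ->
  forall r, x * r = 0 -> r = 0.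
Proof.
move=> /(parameter_rad_m noethR localR dimR)[xm rx] /(frob_betti_dim1 dimR) lim2.
have [N gy] := rad_m_good noethR localR dimR xm rx.
set M := ring_quot [set x] in lim2.
pose S := gen_submod [set x : R^o].
have l0 : linear (fun u : 'rV[R]_1 => quot_pi S (u 0 0 : R^o) : M).
  by move=> a u v; rewrite mxE mxE linearP.
pose pi0 : {linear 'rV[R]_1 -> M} := HB.pack (fun u : 'rV[R]_1 => quot_pi S (u 0 0 : R^o) : M)
  (GRing.isLinear.Build R _ M *:%R _ l0).
have pi0E u : pi0 u = 0 <-> exists r, u 0 0 = r * x.
  exact: iff_trans (quot_pi_eq0 S (u 0 0 : R^o)) (mem_gen_principal x (u 0 0)).
have pi0_surj v : exists u, pi0 u = v.
  by exists (const_mx (repr v)); rewrite /= mxE quot_piK.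
(* Multiplication by [x] maps [R] onto the first syzygy [(x)] of [R/(x)], with kernel the
   annihilator of [x]; degree two of Tor is then governed by generators of that annihilator. *)
have [|f fP] := @ker_factor R 'rV[R]_1 'rV[R]_1 M pi0 (mulmxr x%:M).
  by move=> u; apply/pi0E; exists (u 0 0); rewrite /= mul_mx_scalar mxE mulrC.
have f0 u : f u = 0 <-> x * u 0 0 = 0.
  have fuE : val (f u) = x *: u by rewrite fP /= mul_mx_scalar.
  split=> [fu|xu].
    by have /rowP/(_ 0) := fuE; rewrite fu !mxE.
  apply: val_inj; rewrite fuE; apply/rowP => k; rewrite !mxE ord1.
  exact: xu.
have fsurj z : exists u, f u = z.
  have [r er] := (pi0E (val z)).1 (ker_val z); exists (const_mx r); apply: val_inj.
  by rewrite fP /= mul_mx_scalar; apply/rowP => k; rewrite !mxE ord1 er mulrC.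
have W1 : stable_retract (submod_type (lin_ker pi0)) (syzygy M 1).
  exact: (syzygy_stable_retract pi0_surj (stable_retract_refl M)).
have [e eP] := tor_vanishing noethR localR fsurj W1 gy lim2.
have [yA _] := eP e (leqnn e).
have rk0 : min_rank noethR localR (fg_kernel noethR f) = 0%N.
  apply/eqP; rewrite -leqn0 leqNgt; apply/negP => rk_gt0.
  pose j := Ordinal rk_gt0; pose y := x ^+ N.+1.
  have [_ _ yy /eqP] := gy; apply.
  have xa : x * pres_mx noethR localR f j 0 = 0.
    rewrite /pres_mx mxE; apply/f0; exact: pres_map0.
  (* The row consists of [q]-th powers of elements killed by [x], and [y] is a multiple of [x].
     Hence [y] kills [y] times a basis vector, so that [y * y = 0] and then [y = 0]. *)
  have zA : (y *: delta_mx 0 j : 'rV_(min_rank noethR localR (fg_kernel noethR f))) *m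
      map_mx (frob_pow e charRp) (pres_mx noethR localR f) = 0.
    rewrite -scalemxAl -rowE; apply/rowP => k; rewrite mxE [row _ _ _ _]mxE.
    rewrite [map_mx _ _ _ _]mxE [RHS]mxE ord1 /frob_pow /y exprSr.
    have q0 : (0 < p ^ e)%N by rewrite expn_gt0 prime_gt0 // (pcharf_prime charRp).
    by rewrite -(prednK q0) exprS -mulrA [x * _]mulrA xa mul0r mulr0.
  have /rowP/(_ j) := yA _ zA.
  rewrite !mxE !eqxx => y2; have := yy 1; rewrite !mulr1 => yy1.
  by rewrite -[RHS]yy1 // -[RHS]y2 /= mulr1.
move=> r xr; have /(pres_mxP noethR localR f)[v] : f (const_mx r) = 0 by apply/f0; rewrite mxE.
rewrite (rV_eq0 v rk0) mul0mx => /rowP/(_ 0).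
by rewrite !mxE.
Qed.

(** The sequence [[:: x]] gives depth at least one. For a regular sequence starting with [a] and
    [b], some power of [b] would be a multiple of [a], and cancelling [b] modulo [a] would put [1]
    into [(a)]. *)
Lemma parameter_cohen_macaulay (x : R) : parameter RR x ->
  (forall r, x * r = 0 -> r = 0) -> cohen_macaulay RR m.
Proof.
move=> px regx; have [xm _] := parameter_rad_m noethR localR dimR px.
rewrite /cohen_macaulay dimR; apply/eqP; rewrite eq_le; apply/andP; split.
  apply: ge_ereal_sup => _ [s rs <-]; rewrite lee_fin -[1]/(1%:R) ler_nat leqNgt; apply/negP.
  case: s rs => [|a [|b s]] //= rs _.
  have [/= am reg0] := rs 0%N isT; have [/= bm reg1] := rs 1%N isT.
  have rega : rad_m m a.
    apply: (rad_m_regular noethR localR dimR am) => r ar.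
    (* The first quotient is by the span of the empty set, so its zero class contains only [0]. *)
    have /quot_pi_eq0/asboolP[n [c [g [g0 ->]]]] : quot_pi (gen_submod [set` [::]]) (r : R^o) = 0.
      by apply: reg0; rewrite -linearZ; apply/quot_pi_eq0; rewrite [_ *: _]ar rpred0.
    by rewrite big1 // => i _; have := g0 i.
  have [n [r bn]] := rad_m_exp noethR rega bm.
  have S1 : [set` [:: a]] = [set a : R^o].
    by apply/seteqP; split=> z /=; rewrite inE => /eqP.
  have bk k : quot_pi (gen_submod [set` [:: a]]) (b ^+ k : R^o) = 0 ->
      quot_pi (gen_submod [set` [:: a]]) (1 : R^o) = 0.
    elim: k => // k IH bk; apply: IH; apply: reg1.
    by rewrite -linearZ -[_ *: _]/(b * b ^+ k) -exprS.
  have /bk/quot_pi_eq0 : quot_pi (gen_submod [set` [:: a]]) (b ^+ n : R^o) = 0.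
    by apply/quot_pi_eq0; rewrite S1; apply/mem_gen_principal; exists r.
  rewrite S1 => /mem_gen_principal[t t1].
  by have := idealr1 m; rewrite t1 (idealMr t am).
apply: ereal_sup_ubound; exists [:: x : R^o] => //= -[|//] _; split=> //= v.
rewrite -[v]quot_piK -linearZ => /quot_pi_eq0/asboolP[n [c [g [g0]]]].
rewrite big1 => [xv|i _]; last by have := g0 i.
by rewrite (regx _ xv) linear0.
Qed.

End Main.

Theorem corollary4p9 (RR : realType) (R : comNzRingType) (p : nat)
    (charRp : p \in [pchar R]) (m : idealr R)
    (noethR : noetherian R) (localR : local_ring m)
    (FfinR : F_finite charRp) (dimR : krull_dim RR R^o = 1%E) :
  (forall (M : lmodType R) (i : nat), finite_length RR M -> (1 <= i)%N ->
     frob_betti_is RR charRp m i M R^o 0%E ->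
     frob_betti_is RR charRp m i.+1 M R^o 0%E ->
     (projdim RR M < +oo)%E)
  /\
  (forall x : R, parameter RR x ->
     frob_betti_is RR charRp m 2 (ring_quot [set x]%classic) R^o 0%E ->
     cohen_macaulay RR m).
Proof.
split=> [M [//|i] flM _|x px b2].
  exact: projdim_frob_betti0 (finite_length_fg flM).
exact: parameter_cohen_macaulay px (parameter_regular noethR localR dimR px b2).
Qed.
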